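(* Let $1<p<q$ be real numbers, let $K\subset\mathbb{R}^{n}$ be a centered convex body and let $\Delta_{n}\subset\mathbb{R}^n$ be an $n$-dimensional centered simplex. Then $$\alpha(K)\leq\alpha(\Delta_{n}).$$
   Context: A convex body in $\mathbb{R}^n$ is a compact convex set with non-empty interior. For a convex body $K$, $X\sim Uni(K)$ denotes a random vector uniformly distributed over $K$; $K$ is called centered if $\mathbb{E}[X]=0$. For a real random variable $Y$ and $r\ge 1$, $\|Y\|_r=(\mathbb{E}|Y|^r)^{1/r}$. $S^{n-1}$ is the unit sphere of $\mathbb{R}^n$ centered at the origin. For fixed real numbers $1<p<q$ and a centered convex body $K\subset\mathbb{R}^n$ with $X\sim Uni(K)$, define $$\alpha(K):=\max_{\theta\in S^{n-1}}\frac{\lVert X\cdot\theta\rVert_{q}}{\lVert X\cdot\theta\rVert_{p}}.$$ *)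

(* Defs.v *)
From HB Require Import structures.
From mathcomp Require Import all_boot all_order all_algebra.
From mathcomp Require Import all_classical all_reals all_analysis.
From mathcomp Require Import measurable_realfun.

Set Implicit Arguments.
Unset Strict Implicit.
Unset Printing Implicit Defensive.

Import Order.TTheory GRing.Theory Num.Theory.
Import numFieldNormedType.Exports.

Local Open Scope classical_set_scope.
Local Open Scope ring_scope.

Fact borel_display : measure_display.
Proof. exact: default_measure_display. Qed.

HB.instance Definition _ (R : realType) (m n : nat) :=
  @isMeasurable.Build borel_display 'M[R]_(m, n) <<s @open 'M[R]_(m, n) >>
    (@sigma_algebra0 _ _ _) (@sigma_algebraC _ _) (@sigma_algebra_bigcup _ _ _).

Definition rat_ball (R : realType) (n : nat) (qk : 'rV[rat]_n * nat) :
    set 'rV[R]_n :=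
  ball (\row_i ratr (qk.1 0 i) : 'rV[R]_n) qk.2.+1%:R^-1.

Lemma open_bigcup_rat_ball (R : realType) (n : nat) (U : set 'rV[R]_n) :
  open U -> U = \bigcup_(qk in [set qk | rat_ball qk `<=` U]) rat_ball qk.
Proof.
move=> oU; apply/seteqP; split=> [x Ux|x [qk /= sU xB]]; last exact: sU.
have /nbhs_ballP[e /= e0 eU] : nbhs x U by exact: open_nbhs_nbhs.
have [k ke] : exists k : nat, k.+1%:R^-1 < e / 2.
  have e20 : 0 < e / 2 by rewrite divr_gt0.
  have [k _ kP] := near_infty_natSinv_lt (PosNum e20).
  by exists k; exact: (kP k (leqnn _)).
have k0 : 0 < k.+1%:R^-1 :> R by rewrite invr_gt0.
have [q qP] : {q : 'I_n -> rat & forall i, `|x 0 i - ratr (q i)| < k.+1%:R^-1}.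
  apply: (@choice _ _ (fun i r => `|x 0 i - ratr r| < k.+1%:R^-1)) => i.
  have : x 0 i - k.+1%:R^-1 < x 0 i + k.+1%:R^-1.
    by rewrite ltrBlDr -addrA ltrDl addr_gt0.
  move=> /rat_in_itvoo[r /itvP rx]; exists r.
  by rewrite distrC ltr_distl !rx.
have xB : rat_ball (\row_i q i, k) x.
  by split=> // i j; rewrite !mxE /ball/= distrC (ord1 i); exact: qP.
exists (\row_i q i, k) => //= y yB; apply: eU.
have := ball_triangle (ball_sym xB) yB.
by apply: le_ball; rewrite /= [leRHS]splitr lerD// ltW.
Qed.

Lemma measurable_fun_rV d (T : measurableType d) (R : realType) (n : nat)
    (f : T -> 'rV[R]_n) :
  (forall i, measurable_fun [set: T] (fun x => f x 0 i)) ->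
  measurable_fun [set: T] f.
Proof.
move=> mf; apply: (measurability (@open 'rV[R]_n)) => // _ [U oU <-].
rewrite setTI (open_bigcup_rat_ball oU) preimage_bigcup bigcup_mkcond.
apply: countable_bigcupT_measurable; first exact: countableP.
move=> [q k]; case: ifPn => // _.
rewrite [X in measurable X](_ : _ = \bigcap_(i in [set: 'I_n])
    ((fun x => f x 0 i) @^-1` ball (ratr (q 0 i) : R) k.+1%:R^-1)).
  apply: fin_bigcap_measurable => // i _; rewrite -[X in measurable X]setTI.
  by apply: mf => //; exact: measurable_ball.
apply/seteqP; split=> [x [_ xB] i _|x xB]; first by have := xB 0 i; rewrite mxE.
split=> [|i j]; first by rewrite invr_gt0.
by rewrite (ord1 i) mxE; exact: xB.
Qed.

Lemma measurable_coord (R : realType) (n : nat) (i : 'I_n) :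
  measurable_fun [set: 'rV[R]_n] (fun x => x 0 i).
Proof.
apply: (measurability (@RGenOInfty.G R)) => [|_ [_ [a ->] <-]].
  exact: RGenOInfty.measurableE.
rewrite setTI; apply: sub_sigma_algebra.
by apply: open_comp => [x _|]; [exact: coord_continuous|exact: interval_open].
Qed.

Definition rV_cons (R : realType) (n : nat) (xt : 'rV[R]_n * R) : 'rV[R]_n.+1 :=
  row_mx (xt.2%:M : 'rV_1) xt.1.

Lemma measurable_rV_cons (R : realType) (n : nat) :
  measurable_fun [set: 'rV[R]_n * measurableTypeR R] (@rV_cons R n).
Proof.
apply: measurable_fun_rV => i; rewrite /rV_cons.
under eq_fun do rewrite mxE.
case: (@fintype.split 1 n i) => j; last exact: (measurableT_comp (measurable_coord j)).
by under eq_fun do rewrite (ord1 j) mxE eqxx mulr1n; exact: measurable_snd.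
Qed.


Section lebesgue_rVS.
Context (R : realType) (n : nat) (mu : {measure set 'rV[R]_n -> \bar R}).

Definition lebesgue_rVS : set 'rV[R]_n.+1 -> \bar R :=
  pushforward (mu \x lebesgue_measure)%E (@rV_cons R n).

HB.instance Definition _ := Measure.copy lebesgue_rVS
  (measure_function_pushforward__canonical__measure_function_Measure
    (mu \x lebesgue_measure)%E (@measurable_rV_cons R n)).

End lebesgue_rVS.

(* Lebesgue measure on R^n as the n-fold product of lebesgue_measure; R^0 is a
   point of mass 1. *)
Fixpoint lebesgue_rV (R : realType) (n : nat) :
    {measure set 'rV[R]_n -> \bar R} :=
  if n is n'.+1 then lebesgue_rVS (lebesgue_rV R n') else dirac (0 : 'rV[R]_0).

Record convex_body (R : realType) (n : nat) := ConvexBody {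
  convex_body_set :> set 'rV[R]_n ;
  convex_body_compact : compact convex_body_set ;
  convex_body_convex : convex_set convex_body_set ;
  convex_body_interior : convex_body_set° !=set0 }.

Lemma measurable_convex_body (R : realType) (n : nat) (K : convex_body R n) :
  measurable (K : set 'rV[R]_n).
Proof.
rewrite -[X in measurable X]setCK; apply: measurableC; apply: sub_sigma_algebra.
rewrite openC; apply: compact_closed; last exact: convex_body_compact.
exact: norm_hausdorff.
Qed.

(* The law of a random vector X ~ Uni(K), i.e. A |-> vol(A `&` K) / vol(K); the
   default value \d_0 of mnormalize is irrelevant since 0 < vol(K) < +oo. *)
Definition uniform (R : realType) (n : nat) (K : convex_body R n) :
    probability 'rV[R]_n R :=
  mnormalize (mrestr (lebesgue_rV R n) (measurable_convex_body K))
    (dirac (0 : 'rV[R]_n)).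

Definition centered (R : realType) (n : nat) (K : convex_body R n) :=
  forall i, ('E_(uniform K)[fun x => (x 0 i)%R] = 0)%E.

Definition dot {R : realType} {n : nat} (x y : 'rV[R]_n) : R :=
  \sum_i x 0 i * y 0 i.

(* The norm `|x| of 'rV[R]_n is the sup norm, hence the explicit formula. *)
Definition unit_sphere (R : realType) (n : nat) : set 'rV[R]_n :=
  [set theta | Num.sqrt (dot theta theta) = 1].

(* || X . theta ||_r for X ~ Uni(K). *)
Definition marginal_norm (R : realType) (n : nat) (K : convex_body R n) (r : R)
    (theta : 'rV[R]_n) : R :=
  fine ('N[uniform K]_(r%:E)[EFin \o dot^~ theta])%E.

Definition is_maximum (R : realType) (E : set R) (m : R) := E m /\ ubound E m.

(* For 0 < n the maximum exists, by continuity and compactness of the sphere,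
   and the default value 0 is not used. *)
Definition alpha (R : realType) (n : nat) (p q : R) (K : convex_body R n) : R :=
  xget 0 (is_maximum [set marginal_norm K q theta / marginal_norm K p theta
                     | theta in @unit_sphere R n]).

Definition affinely_independent (R : realType) (n k : nat)
    (v : 'I_k -> 'rV[R]_n) :=
  forall c : 'I_k -> R, \sum_i c i = 0 -> \sum_i c i *: v i = 0 ->
    forall i, c i = 0.

Definition convex_hull (R : realType) (n k : nat) (v : 'I_k -> 'rV[R]_n) :
    set 'rV[R]_n :=
  [set \sum_i c i *: v i | c in [set c : 'I_k -> R |
                                  (forall i, 0 <= c i) /\ \sum_i c i = 1]].

Definition is_simplex (R : realType) (n : nat) (D : set 'rV[R]_n) :=
  exists2 v : 'I_n.+1 -> 'rV[R]_n, affinely_independent v & D = convex_hull v.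

(* Main.v *)
(* For a centered Y = X.th, let U(s) = E(Y - s)_+, so that E(s - Y)_+ = U(s) + s.
   By Prekopa-Leindler, the (n+1)-th roots of U(s) and U(s) + s are concave.
   Marginals of a simplex that send all but two vertices to one point t (the
   knot) have a stop-loss transform T for which the root of T is affine on
   [t, oo[ and the root of T(s) + s is affine on ]-oo, t], up to truncation at 0.
   This extremality makes {T <= U} an interval, within the range of Y.

   Such marginals form, up to scaling, a segment of directions joining two facet
   normals. By the intermediate value theorem and scaling, one of them has the
   same E Y_+^p and E Y_-^p as X.th. Since E Y_+^p is a constant times the
   integral over r > 0 of U(r^(1/(p-1))), T - U changes sign once on each half
   line, from - to + going away from 0; weighting the integral by the increasing
   function r^((q-p)/(p-1)) gives E T_+^q >= E Y_+^q, and likewise for Y_-. *)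

From HB Require Import structures.
Require Import Defs.
From mathcomp Require Import all_boot all_order all_algebra.
From mathcomp Require Import all_classical all_reals all_analysis.
From mathcomp Require Import measurable_realfun ring lra.

Set Implicit Arguments.
Unset Strict Implicit.
Unset Printing Implicit Defensive.

Import Order.TTheory GRing.Theory Num.Theory.
Import numFieldNormedType.Exports.
Local Open Scope classical_set_scope.
Local Open Scope ring_scope.

(** The knot of [T] need not be 0, and the two concavity properties of [U] compare with [T] on
    different sides of it. Convexity glues the two comparisons. Let [-a] and [-b] be subgradients of
    [U] and [T] at the knot, and suppose that [T] is above [U] there. If [b <= a], then [T] stays
    above [U] to the right; otherwise [1 - b < 1 - a], and the same argument for the transforms of
    -Y keeps [T] above [U] to the left. So [T <= U] at points on both sides, inside the range,
    forces it at the knot.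

    Such points exist on each half line because the positive and the negative p-th moments agree
    separately; this is why both are matched and not only their sum. Matching is two equations in
    two unknowns: a scale, which multiplies both moments by the same factor, and the ratio of two
    weights. The signs at the ends, for the intermediate value theorem, come from one-sided cones:
    the marginal along a facet normal has no mass on one side of the knot, which makes the ratio of
    its p-th moments extreme. *)

(** * Lebesgue measure on row vectors: cubes, Tonelli, affine substitution *)

Lemma rV_cons0 (R : realType) (n : nat) (y : 'rV[R]_n) (t : R) :
  rV_cons (y, t) 0 0 = t.
Proof.
rewrite (_ : 0 = lshift n (0 : 'I_1) :> 'I_(1 + n)); last exact/val_inj.
by rewrite [LHS](@row_mxEl _ 1 1 n) mxE eqxx mulr1n.
Qed.

Lemma rV_consS (R : realType) (n : nat) (y : 'rV[R]_n) (t : R) (j : 'I_n) :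
  rV_cons (y, t) 0 (lift ord0 j) = y 0 j.
Proof. by rewrite -rshift1 [LHS](@row_mxEr _ 1 1 n). Qed.

Definition rV_tail (R : realType) (n : nat) (x : 'rV[R]_n.+1) : 'rV[R]_n :=
  \row_j x 0 (lift ord0 j).

Lemma preimage_rV_cons_ball (R : realType) (n : nat) (x : 'rV[R]_n.+1) (r : R) :
  @rV_cons R n @^-1` ball x r = ball (rV_tail x) r `*` ball (x 0 0) r.
Proof.
apply/seteqP; split=> [[y t] [r0 h]|[y t] [[r0 h1] h2]] /=.
  split; last by have := h 0 0; rewrite rV_cons0.
  split=> // i j; rewrite mxE (ord1 i).
  by have := h 0 (lift ord0 j); rewrite rV_consS.
split=> // i j; rewrite (ord1 i).
have [k ->|->] := unliftP ord0 j; last by rewrite rV_cons0.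
by rewrite rV_consS; have := h1 0 k; rewrite mxE.
Qed.

Lemma measurable_ball_rV (R : realType) (n : nat) (x : 'rV[R]_n) (r : R) :
  measurable (ball x r).
Proof. by apply: sub_sigma_algebra; exact: ball_open. Qed.

(** A ball of the sup norm is a cube, so the product measure splits along [rV_cons]. Cubes are
    enough for sigma-finiteness and for bounding the volume of a body from both sides. *)
Lemma lebesgue_rV_ball (R : realType) (n : nat) (x : 'rV[R]_n) (r : R) : 0 < r ->
  lebesgue_rV R n (ball x r) = ((r *+ 2) ^+ n)%:E.
Proof.
move=> r0; elim: n x => [|n IH] x.
  rewrite /= diracE expr0 mem_set//; split=> // i j; by case: j.
rewrite [LHS](_ : _ = ((lebesgue_rV R n) \x lebesgue_measure)%E
    (@rV_cons R n @^-1` ball x r))// preimage_rV_cons_ball.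
rewrite product_measure1E//; [|exact: measurable_ball_rV|exact: measurable_ball].
have E : lebesgue_measure (ball (x 0 0) r) = (r *+ 2)%:E.
  exact/lebesgue_measure_ball/ltW.
by rewrite IH exprS mulrC EFinM -E.
Qed.

Lemma lebesgue_rV_sigma_finite (R : realType) (n : nat) :
  sigma_finite [set: 'rV[R]_n] (lebesgue_rV R n).
Proof.
exists (fun k => ball 0 k.+1%:R).
  apply/seteqP; split=> // x _.
  exists (Num.truncn `|x|) => //=.
  rewrite -ball_normE/= sub0r normrN.
  by have /andP[] := truncn_itv (normr_ge0 x).
move=> k; split; first exact: measurable_ball_rV.
by rewrite lebesgue_rV_ball// ltry.
Qed.

(** An alias of the recursively defined measure, on which the sigma-finite structure required by
    Tonelli is declared. *)
Definition lebesgue_rV_sf (R : realType) (n : nat) : set 'rV[R]_n -> \bar R :=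
  lebesgue_rV R n.

HB.instance Definition _ (R : realType) (n : nat) :=
  Measure.copy (@lebesgue_rV_sf R n) (lebesgue_rV R n).

HB.instance Definition _ (R : realType) (n : nat) :=
  @Measure_isSigmaFinite.Build _ _ _ (@lebesgue_rV_sf R n)
    (@lebesgue_rV_sigma_finite R n).

Lemma integral_rVS (R : realType) (n : nat) (f : 'rV[R]_n.+1 -> \bar R) :
  measurable_fun [set: 'rV[R]_n.+1] f -> (forall x, 0 <= f x)%E ->
  (\int[lebesgue_rV R n.+1]_x f x =
   \int[lebesgue_rV R n]_x \int[lebesgue_measure]_t f (rV_cons (x, t)))%E.
Proof.
move=> mf f0.
have mfc : measurable_fun setT (f \o @rV_cons R n).
  by apply: measurableT_comp => //; exact: measurable_rV_cons.
apply: etrans (fubini_tonelli1 (m1 := @lebesgue_rV_sf R n)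
  (m2 := lebesgue_measure) (f \o @rV_cons R n) mfc _); last by move=> x; exact: f0.
exact: (ge0_integral_pushforward (@measurable_rV_cons R n)
  ((lebesgue_rV R n \x lebesgue_measure)%E) measurableT mf (fun x _ => f0 x)).
Qed.

Lemma measurable_integral_rV_cons (R : realType) (n : nat)
    (f : 'rV[R]_n.+1 -> \bar R) :
  measurable_fun [set: 'rV[R]_n.+1] f -> (forall x, 0 <= f x)%E ->
  measurable_fun [set: 'rV[R]_n]
    (fun x => \int[lebesgue_measure]_t f (rV_cons (x, t)))%E.
Proof.
move=> mf f0.
apply: (measurable_fun_fubini_tonelli_F (m2 := lebesgue_measure)
  (f \o @rV_cons R n)); last by move=> x; exact: f0.
by apply: measurableT_comp => //; exact: measurable_rV_cons.
Qed.

(** The push-forward of Lebesgue measure by the affine map, multiplied by [a], gives half-open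
    intervals their length, so it is Lebesgue measure by uniqueness. *)
Lemma ge0_integral_affine1 (R : realType) (a b : R) (f : R -> \bar R) :
  0 < a -> measurable_fun [set: R] f -> (forall x, 0 <= f x)%E ->
  (\int[lebesgue_measure]_t f (a * t + b)%R =
   a^-1%:E * \int[lebesgue_measure]_t f t)%E.
Proof.
move=> a0 mf f0.
pose phi (t : R) : measurableTypeR R := a * t + b.
have mphi : measurable_fun [set: measurableTypeR R] phi.
  by apply: measurable_funD => //; exact: measurable_funM.
pose P : {measure set _ -> \bar R} :=
  measure_function_pushforward__canonical__measure_function_Measure
    (@lebesgue_measure R) mphi.
have PE A : measurable A -> lebesgue_measure A = mscale (NngNum (ltW a0)) P A.
  apply: lebesgue_measure_unique => _ [[c d] /= _ <-].
  rewrite /mscale/= /pushforward.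
  rewrite (_ : phi @^-1` _ = `](c - b) / a, (d - b) / a]%classic); last first.
    apply/seteqP; split=> t /=; rewrite !in_itv/= /phi ltr_pdivrMr// ler_pdivlMr//;
    by rewrite ltrBlDr lerBrDr (mulrC t).
  rewrite !lebesgue_measure_itv/= !lte_fin ltr_pM2r ?invr_gt0// ltrD2r.
  case: ifPn => _; last by rewrite mule0.
  by rewrite -!EFinD -EFinM; congr EFin; field; exact: lt0r_neq0.
have -> : (\int[lebesgue_measure]_t f t = a%:E * \int[P]_t f t)%E.
  rewrite -(ge0_integral_mscale P measurableT (NngNum (ltW a0)) mf)//.
  by apply: eq_measure_integral => A mA _; exact: PE.
rewrite muleA -EFinM mulVf ?lt0r_neq0// mul1e.
by rewrite [RHS](ge0_integral_pushforward mphi).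
Qed.

Lemma measurable_affine_rV (R : realType) (n : nat) (a : R) (c : 'rV[R]_n) :
  measurable_fun [set: 'rV[R]_n] (fun x : 'rV[R]_n => a *: x + c).
Proof.
apply: measurable_fun_rV => i; under eq_fun do rewrite !mxE.
by apply: measurable_funD => //; apply: measurable_funM => //; exact: measurable_coord.
Qed.

Lemma measurable_rV_cons_section (R : realType) (n : nat) d (T : measurableType d)
    (f : 'rV[R]_n.+1 -> T) (x : 'rV[R]_n) :
  measurable_fun [set: 'rV[R]_n.+1] f ->
  measurable_fun [set: measurableTypeR R] (fun t => f (rV_cons (x, t))).
Proof.
move=> mf; apply: measurableT_comp => //.
apply: (measurableT_comp (@measurable_rV_cons R n)).
exact: measurable_pair1.
Qed.

(** It serves twice: with [c = 0] for the dilations behind root concavity, and with a translation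
    that fixes a vertex for the homotheties of a simplex. *)
Lemma ge0_integral_affine_rV (R : realType) (n : nat) (a : R) (c : 'rV[R]_n)
    (f : 'rV[R]_n -> \bar R) :
  0 < a -> measurable_fun [set: 'rV[R]_n] f -> (forall x, 0 <= f x)%E ->
  (\int[lebesgue_rV R n]_x f (a *: x + c)%R =
   (a ^- n)%:E * \int[lebesgue_rV R n]_x f x)%E.
Proof.
move=> a0; elim: n c f => [|n IH] c f mf f0.
  rewrite expr0 invr1 mul1e; apply: eq_integral => x _; congr f.
  by apply/rowP => -[].
have maff : measurable_fun setT (fun x : 'rV[R]_n.+1 => f (a *: x + c)).
  by apply: measurableT_comp => //; exact: measurable_affine_rV.
rewrite integral_rVS// integral_rVS//.
pose g x := (\int[lebesgue_measure]_t f (rV_cons (x, t)))%E.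
have mg : measurable_fun setT g by exact: measurable_integral_rV_cons.
have g0 x : (0 <= g x)%E by exact: integral_ge0.
transitivity (\int[lebesgue_rV R n]_x (a^-1%:E * g (a *: x + rV_tail c)%R))%E.
  apply: eq_integral => x _.
  rewrite -(ge0_integral_affine1 (c 0 0)) //; last first.
    exact: measurable_rV_cons_section.
  apply: eq_integral => t _; congr f; apply/rowP => j; rewrite [LHS]mxE [X in X + _]mxE.
  have [k ->|->] := unliftP ord0 j; last by rewrite !rV_cons0.
  by rewrite !rV_consS [RHS]mxE [X in _ = X + _]mxE [X in _ = _ + X]mxE.
have mga : measurable_fun setT (fun x : 'rV[R]_n => g (a *: x + rV_tail c)).
  by apply: measurableT_comp => //; exact: measurable_affine_rV.
have a'0 : 0 <= a^-1 by rewrite invr_ge0 ltW.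
rewrite (ge0_integralZl_EFin _ measurableT (fun x _ => g0 _) mga a'0).
by rewrite (IH _ _ mg g0) muleA -EFinM exprS invfM.
Qed.

(** * The Prekopa-Leindler inequality on the line *)

Lemma integral_indic_setT d (T : measurableType d) (R : realType)
    (mu : {measure set T -> \bar R}) (A : set T) : measurable A ->
  (\int[mu]_x (\1_A x)%:E = mu A)%E.
Proof. by move=> mA; rewrite integral_indic// setIT. Qed.

Section layer_cake.
Context (R : realType).
Let mu := @lebesgue_measure R.

(** Written as a section integral of the subgraph, with [0 <= t] built in: measurability in [t] and
    the layer-cake formula are then both instances of Tonelli. *)
Definition level_measure (f : R -> R) (t : R) : \bar R :=
  (\int[mu]_x (\1_[set z : measurableTypeR R * measurableTypeR R | 0 <= z.1 < f z.2] (t, x))%:E)%E.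

Lemma measurable_subgraph (f : R -> R) : measurable_fun setT f ->
  measurable [set z : measurableTypeR R * measurableTypeR R | 0 <= z.1 < f z.2].
Proof.
move=> mf.
rewrite (_ : [set _ | _] = [set z : measurableTypeR R * measurableTypeR R | 0 <= z.1] `&`
  [set z : measurableTypeR R * measurableTypeR R| z.1 < f z.2]); last first.
  by apply/seteqP; split=> z /= /andP.
apply: measurableI.
  have : measurable_fun [set: measurableTypeR R * measurableTypeR R]
      (fun z => 0 <= z.1 :> R).
    by apply: measurable_fun_ler => //; exact: measurable_fst.
  by move=> /(_ measurableT [set true]); rewrite setTI; exact.
have mf2 : measurable_fun [set: measurableTypeR R * measurableTypeR R] (f \o snd).
  exact: measurableT_comp.
have : measurable_fun [set: measurableTypeR R * measurableTypeR R]
    (fun z => z.1 < f z.2 :> R).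
  by apply: measurable_fun_ltr => //; exact: measurable_fst.
by move=> /(_ measurableT [set true]); rewrite setTI; exact.
Qed.

Lemma measurable_level_measure (f : R -> R) : measurable_fun setT f ->
  measurable_fun setT (level_measure f).
Proof.
move=> mf.
apply: (measurable_fun_fubini_tonelli_F (m2 := mu) (EFin \o \1_[set z | 0 <= z.1 < f z.2])).
  by apply/measurable_EFinP; apply: measurable_indic; exact: measurable_subgraph.
by move=> x; rewrite lee_fin.
Qed.

Lemma measurable_superlevel (f : R -> R) (t : R) : measurable_fun setT f ->
  measurable ([set x | t < f x] : set (measurableTypeR R)).
Proof.
move=> mf; rewrite (_ : mkset _ = f @^-1` `]t, +oo[%classic).
  by rewrite -[X in measurable X]setTI; exact: mf.
by apply/seteqP; split=> x /=; rewrite in_itv/= andbT.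
Qed.

Lemma level_measureE (f : R -> R) (t : R) : measurable_fun setT f -> 0 <= t ->
  level_measure f t = mu [set x | t < f x].
Proof.
move=> mf t0; rewrite -[RHS]integral_indic_setT; last exact: measurable_superlevel.
by apply: eq_integral => x _; rewrite !indicE/= /in_mem/= /in_set/= t0.
Qed.

Lemma layer_cake (f : R -> R) : measurable_fun setT f -> (forall x, 0 <= f x) ->
  (\int[mu]_x (f x)%:E = \int[mu]_t (level_measure f t))%E.
Proof.
move=> mf f0; pose A := [set z : measurableTypeR R * measurableTypeR R | 0 <= z.1 < f z.2].
have mA : measurable_fun setT (EFin \o (\1_A : _ -> R)).
  by apply/measurable_EFinP; apply: measurable_indic; exact: measurable_subgraph.
have A0 z : (0 <= (EFin \o (\1_A : _ -> R)) z)%E by rewrite lee_fin.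
rewrite [RHS](fubini_tonelli (m1 := mu) (m2 := mu) _ mA A0).
apply: eq_integral => x _.
transitivity (mu (`[0, f x[%classic)).
  by rewrite /mu lebesgue_measure_itv/= lte_fin sube0; case: ltrgt0P (f0 x) => // ->.
apply: etrans (esym (integral_indic_setT mu (measurable_itv _))) _.
apply: eq_integral => t _.
by rewrite /= !indicE; congr ((nat_of_bool _)%:R%:E).
Qed.
End layer_cake.

Lemma lebesgue_measure_le_width (R : realType) (A : set R) : measurable A ->
  A !=set0 -> has_lbound A -> has_ubound A ->
  (lebesgue_measure A <= (sup A - inf A)%:E)%E.
Proof.
move=> mA A0 lA uA.
have -> : (sup A - inf A)%:E = lebesgue_measure (`[inf A, sup A] : set R).
  rewrite lebesgue_measure_itv/= lte_fin; case: ltP => //.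
  have [x Ax] := A0.
  have h1 : inf A <= x by apply: ge_inf.
  have h2 : x <= sup A by apply: ub_le_sup.
  by move=> h; congr EFin; lra.
apply: le_measure; rewrite ?inE//.
by move=> x Ax /=; rewrite in_itv/= ge_inf// ub_le_sup.
Qed.

(** [C] contains the open interval between the combination of the infima and that of the suprema,
    and its length is the combination of the widths. Intervals are the superlevel sets of
    quasiconcave functions. *)
Lemma brunn_minkowski_itv (R : realType) (A B C : set R) (l : R) : 0 < l < 1 ->
  measurable A -> measurable B -> measurable C -> is_interval A -> is_interval B ->
  A !=set0 -> has_lbound A -> has_ubound A ->
  B !=set0 -> has_lbound B -> has_ubound B ->
  (forall x y, A x -> B y -> C ((1 - l) * x + l * y)) ->
  ((1 - l)%:E * lebesgue_measure A + l%:E * lebesgue_measure B <=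
   lebesgue_measure C)%E.
Proof.
move=> /andP[l0 l1] mA mB mC iA iB A0 lA uA B0 lB uB ABC.
have l'0 : 0 < 1 - l by lra.
set a := (1 - l) * inf A + l * inf B; set b := (1 - l) * sup A + l * sup B.
apply: (@le_trans _ _ ((b - a)%:E)).
  apply: (@le_trans _ _ ((1 - l)%:E * (sup A - inf A)%:E + l%:E * (sup B - inf B)%:E)%E).
    by apply: leeD; apply: lee_wpmul2l; rewrite ?lee_fin ?(ltW l0) ?(ltW l'0)//;
      exact: lebesgue_measure_le_width.
  by rewrite -!EFinM -EFinD lee_fin /a /b; lra.
apply: (@le_trans _ _ (lebesgue_measure (`]a, b[ : set R))).
  by rewrite lebesgue_measure_itv/= lte_fin; case: ltP => //; rewrite lee_fin; lra.
apply: le_measure; rewrite ?inE//.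
move=> z /=; rewrite in_itv/= => /andP[az zb].
have [x1 [y1 [Ax1 By1 z1]]] : exists x y, [/\ A x, B y & (1 - l) * x + l * y < z].
  have e0 : 0 < z - a by lra.
  have [x Ax hx] := inf_adherent e0 (conj A0 lA).
  have [y By hy] := inf_adherent e0 (conj B0 lB).
  exists x, y; split=> //.
  have : (1 - l) * x < (1 - l) * (inf A + (z - a)) by rewrite ltr_pM2l.
  have : l * y < l * (inf B + (z - a)) by rewrite ltr_pM2l.
  by rewrite /a; lra.
have [x2 [y2 [Ax2 By2 z2]]] : exists x y, [/\ A x, B y & z < (1 - l) * x + l * y].
  have e0 : 0 < b - z by lra.
  have [x Ax hx] := sup_adherent e0 (conj A0 uA).
  have [y By hy] := sup_adherent e0 (conj B0 uB).
  exists x, y; split=> //.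
  have : (1 - l) * (sup A - (b - z)) < (1 - l) * x by rewrite ltr_pM2l.
  have : l * (sup B - (b - z)) < l * y by rewrite ltr_pM2l.
  by rewrite /b; lra.
set u := (1 - l) * x1 + l * y1 in z1; set v := (1 - l) * x2 + l * y2 in z2.
(* The same parameter moves [x1] to [x2] and [y1] to [y2]; the combination then runs from [u < z] to
   [v > z] and equals [z] at [s]. *)
pose s := (z - u) / (v - u).
have vu : 0 < v - u by lra.
have s01 : 0 <= s <= 1 by rewrite divr_ge0 ?ler_pdivrMr//; lra.
have conv_itv (D : set R) c d : is_interval D -> D c -> D d -> D (c + s * (d - c)).
  move=> iD Dc Dd; case/andP: s01 => s0 s1; have [cd|dc] := leP c d.
    apply: (iD c d) => //; apply/andP; split; first by rewrite lerDl mulr_ge0//; lra.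
    by have := ler_wpM2r (_ : 0 <= d - c) s1; lra.
  apply: (iD d c) => //; apply/andP; split.
    by have := ler_wpM2r (_ : 0 <= c - d) s1; lra.
  by have := mulr_ge0 s0 (_ : 0 <= c - d); lra.
have -> : z = (1 - l) * (x1 + s * (x2 - x1)) + l * (y1 + s * (y2 - y1)).
  have -> : (1 - l) * (x1 + s * (x2 - x1)) + l * (y1 + s * (y2 - y1)) = u + s * (v - u).
    by rewrite /u /v; ring.
  by rewrite /s divfK ?lt0r_neq0//; ring.
by apply: ABC; exact: conv_itv.
Qed.

(** One constant bounds the values and the support, so that a single parameter passes through the
    induction on the dimension. *)
Definition bsupp (R : realType) (V : normedModType R) (M : R) (f : V -> R) :=
  (forall x, 0 <= f x <= M) /\ (forall x, M < `|x| -> f x = 0).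

Lemma integrable_bounded_on d (T : measurableType d) (R : realType)
    (mu : {measure set T -> \bar R}) (D : set T) (f : T -> R) (M : R) :
  measurable D -> (mu D < +oo)%E -> measurable_fun D f ->
  (forall x, D x -> `|f x| <= M) -> mu.-integrable D (EFin \o f).
Proof.
move=> mD Doo mf fM; apply: measurable_bounded_integrable => //.
exists M; split; first exact: num_real.
by move=> N MN x Dx; exact: le_trans (fM _ Dx) (ltW MN).
Qed.

Lemma integrable_support d (T : measurableType d) (R : realType)
    (mu : {measure set T -> \bar R}) (D : set T) (f : T -> R) (M : R) :
  measurable D -> (mu D < +oo)%E -> measurable_fun setT f ->
  (forall x, D x -> `|f x| <= M) -> (forall x, ~ D x -> f x = 0) ->
  mu.-integrable setT (EFin \o f).
Proof.
move=> mD Doo mf fM f0.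
have : mu.-integrable D (EFin \o f).
  by apply: integrable_bounded_on fM => //; exact: measurable_funTS.
move/(integrable_mkcond _ mD); apply: eq_integrable => // x _.
by rewrite patchE; case: ifPn => // /negP xD; rewrite /= f0// => /mem_set.
Qed.

Lemma bsupp_integrable1 (R : realType) (M : R) (f : R -> R) :
  bsupp M (f : R^o -> R) -> measurable_fun setT f ->
  (@lebesgue_measure R).-integrable setT (EFin \o f).
Proof.
move=> [fM f0] mf.
apply: (@integrable_support _ (measurableTypeR R) R (@lebesgue_measure R) (`[- M, M]%classic) f M) => //.
- exact: (compact_finite_measure (@segment_compact R (- M) M)).
- by move=> x _; have /andP[h1 h2] := fM x; rewrite ger0_norm.
- by move=> x; rewrite /= in_itv/= -ler_norml => /negP; rewrite -ltNge; exact: f0.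
Qed.

Definition quasiconcave (R : realType) (f : R -> R) :=
  forall x y z, x <= z <= y -> Num.min (f x) (f y) <= f z.

(** Both suprema are normalised to 1, so for every [t < 1] both superlevel sets are non-empty, as
    Brunn-Minkowski demands. Integrating over [0 <= t < 1] gives the bound. *)
Lemma integral_min_le (R : realType) (f g h : R -> R) (M l : R) : 0 < l < 1 ->
  measurable_fun setT f -> measurable_fun setT g -> measurable_fun setT h ->
  (forall x, 0 <= f x <= 1) -> (forall x, 0 <= g x <= 1) -> (forall x, 0 <= h x) ->
  (forall x, M < `|x| -> f x = 0) -> (forall x, M < `|x| -> g x = 0) ->
  quasiconcave f -> quasiconcave g ->
  (forall t, t < 1 -> exists x, t < f x) ->
  (forall t, t < 1 -> exists x, t < g x) ->
  (forall x y, Num.min (f x) (g y) <= h ((1 - l) * x + l * y)) ->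
  ((1 - l)%:E * \int[lebesgue_measure]_x (f x)%:E +
   l%:E * \int[lebesgue_measure]_x (g x)%:E <=
   \int[lebesgue_measure]_x (h x)%:E)%E.
Proof.
move=> l01 mf mg mh f1 g1 h0 fM gM qf qg supf supg fgh.
have l0 : 0 <= l by lra.
have l'0 : 0 <= 1 - l by lra.
have f0 x : 0 <= f x by have /andP[] := f1 x.
have g0 x : 0 <= g x by have /andP[] := g1 x.
rewrite !layer_cake//.
have lev0 (k : R -> R) t : (0 <= level_measure k t)%E.
  by apply: integral_ge0 => x _; rewrite lee_fin.
have mlev := @measurable_level_measure R.
rewrite -!ge0_integralZl_EFin//; [|exact: mlev|exact: mlev].
rewrite -ge0_integralD//; last 4 first.
- by move=> t _; rewrite mule_ge0.
- by apply: measurable_funeM; exact: mlev.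
- by move=> t _; rewrite mule_ge0.
- by apply: measurable_funeM; exact: mlev.
apply: ge0_le_integral => //.
- by move=> t _; rewrite adde_ge0// mule_ge0.
- by apply: emeasurable_funD; apply: measurable_funeM; exact: mlev.
- exact: mlev.
move=> t _.
have [t0|t0] := ltP t 0.
  have lev_neg (k : R -> R) : level_measure k t = 0%E.
    apply: integral0_eq => x _; rewrite indicE memNset//= => /andP[].
    by rewrite leNgt t0.
  by rewrite !lev_neg !mule0 adde0.
have [t1|t1] := ltP t 1; last first.
  have lev_big (k : R -> R) : (forall x, 0 <= k x <= 1) -> level_measure k t = 0%E.
    move=> k1; apply: integral0_eq => x _; rewrite indicE memNset//= => /andP[_].
    by have /andP[_ kx1] := k1 x; rewrite ltNge (le_trans kx1).
  by rewrite (lev_big f)// (lev_big g)// !mule0 adde0.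
rewrite !level_measureE//.
have itv (k : R -> R) : quasiconcave k -> is_interval [set x | t < k x].
  move=> qk x y /= tx ty z xzy; apply: lt_le_trans (qk _ _ _ xzy).
  by rewrite lt_min tx ty.
have bd (k : R -> R) : (forall x, M < `|x| -> k x = 0) ->
    has_lbound [set x | t < k x] /\ has_ubound [set x | t < k x].
  move=> kM; have kin x : t < k x -> - M <= x <= M.
    move=> tk; rewrite -ler_norml leNgt; apply/negP => /kM k0.
    by move: tk; rewrite k0 ltNge t0.
  by split; [exists (- M)|exists M] => x /= /kin /andP[].
have [lf uf] := bd _ fM; have [lg ug] := bd _ gM.
apply: brunn_minkowski_itv => //; try exact: measurable_superlevel.
- exact: itv.
- exact: itv.
- exact: supf.
- exact: supg.
- move=> x y /= tx ty; apply: lt_le_trans (fgh _ _).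
  by rewrite lt_min tx ty.
Qed.

Lemma weighted_AMGM (R : realType) (a b l : R) : 0 <= a -> 0 <= b -> 0 < l < 1 ->
  a `^ (1 - l) * b `^ l <= (1 - l) * a + l * b.
Proof.
move=> a0 b0 /andP[l0 l1].
have l'0 : 0 < 1 - l by lra.
have := @conjugate_powR R (a `^ (1 - l)) (b `^ l) (1 - l)^-1 l^-1
  (powR_ge0 _ _) (powR_ge0 _ _).
rewrite !invr_gt0 !invrK -!powRrM !divff ?lt0r_neq0// !powRr1// => h.
by rewrite mulrC (mulrC l) (mulrC (1 - l)) mulrC; apply: h => //; lra.
Qed.

(** Dividing [f] and [g] by their suprema and [h] by the geometric mean of these suprema reduces to
    [integral_min_le], since a minimum is at most a geometric mean. The result bounds an arithmetic
    mean of the integrals, which dominates the geometric mean wanted. *)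
Lemma prekopa_leindler1 (R : realType) (f g h : R -> R) (M l : R) : 0 < l < 1 ->
  measurable_fun setT f -> measurable_fun setT g -> measurable_fun setT h ->
  bsupp M (f : R^o -> R) -> bsupp M (g : R^o -> R) -> bsupp M (h : R^o -> R) ->
  quasiconcave f -> quasiconcave g ->
  (forall x y, f x `^ (1 - l) * g y `^ l <= h ((1 - l) * x + l * y)) ->
  (\int[lebesgue_measure]_x f x) `^ (1 - l) * (\int[lebesgue_measure]_x g x) `^ l
    <= \int[lebesgue_measure]_x h x.
Proof.
move=> l01 mf mg mh bf bg bh qf qg fgh.
have [l0 l1] := andP l01; have l'0 : 0 < 1 - l by lra.
have If0 (k : R -> R) : bsupp M (k : R^o -> R) -> 0 <= \int[lebesgue_measure]_x k x.
  by move=> bk; apply: Rintegral_ge0 => x _; have /andP[] := bk.1 x.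
have pos (k : R -> R) : bsupp M (k : R^o -> R) -> \int[lebesgue_measure]_x k x != 0 ->
    0 < sup (range k) /\ forall x, k x <= sup (range k).
  move=> bk Ik.
  have kub : has_ubound (range k).
    by exists M => _ [x _ <-]; have /andP[] := bk.1 x.
  have ks x : k x <= sup (range k) by apply: ub_le_sup => //; exists x.
  split=> //; rewrite lt_neqAle; apply/andP; split; last first.
    by apply: le_trans (ks 0); have /andP[] := bk.1 0.
  apply: contra Ik => /eqP s0; rewrite /Rintegral integral0_eq//= => x _.
  congr EFin; apply/eqP; rewrite eq_le; have := ks x; rewrite -s0 => ->.
  by have /andP[] := bk.1 x.
have [If|If] := eqVneq (\int[lebesgue_measure]_x f x) 0.
  by rewrite If powR0 ?lt0r_neq0// mul0r If0.
have [Ig|Ig] := eqVneq (\int[lebesgue_measure]_x g x) 0.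
  by rewrite Ig (powR0 (lt0r_neq0 l0)) mulr0 If0.
have [F0 fF] := pos f bf If; have [G0 gG] := pos g bg Ig.
set F := sup _ in F0 fF; set G := sup (range g) in G0 gG.
pose H := F `^ (1 - l) * G `^ l.
have H0 : 0 < H by rewrite mulr_gt0 ?powR_gt0.
have supk (k : R -> R) : 0 < sup (range k) ->
    forall t, t < 1 -> exists x, t < (sup (range k))^-1 * k x.
  move=> sk0 t t1.
  have [_ [x _ <-] hx] : exists2 y, range k y & t * sup (range k) < y.
    apply: sup_gt; first by exists (k 0), 0.
    by rewrite gtr_pMl.
  by exists x; rewrite mulrC ltr_pdivlMr.
have kx0 (k : R -> R) x : bsupp M (k : R^o -> R) -> 0 <= k x.
  by move=> bk; have /andP[] := bk.1 x.
have k01 (k : R -> R) (s : R) x : bsupp M (k : R^o -> R) -> 0 < s -> k x <= s -> 0 <= s^-1 * k x <= 1.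
  move=> bk s0 ks; rewrite mulr_ge0 ?invr_ge0 ?(ltW s0)//=; last exact: kx0.
  by rewrite mulrC ler_pdivrMr// mul1r.
have qk (k : R -> R) (s : R) : quasiconcave k -> 0 < s -> quasiconcave (fun x => s^-1 * k x).
  move=> qqk s0 x y z xzy; have si0 : 0 <= s^-1 by rewrite invr_ge0 ltW.
  by rewrite -(minr_pMr _ _ si0); apply: ler_wpM2l => //; exact: qqk.
have mk (k : R -> R) (s : R) : measurable_fun setT k ->
    measurable_fun setT (fun x => s^-1 * k x).
  by move=> mmk; apply: measurable_funM.
have := @integral_min_le R (fun x => F^-1 * f x) (fun x => G^-1 * g x)
  (fun x => H^-1 * h x) M l l01 (mk _ _ mf) (mk _ _ mg) (mk _ _ mh)
  (fun x => k01 f F x bf F0 (fF x)) (fun x => k01 g G x bg G0 (gG x)).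
have EI (k : R -> R) (s : R) : bsupp M (k : R^o -> R) -> measurable_fun setT k -> 0 < s ->
    (\int[lebesgue_measure]_x (s^-1 * k x)%:E =
     (s^-1 * \int[lebesgue_measure]_x k x)%:E)%E.
  move=> bk mmk s0.
  have ik := bsupp_integrable1 bk mmk.
  rewrite -RintegralZl// /Rintegral fineK//.
  by apply: integrable_fin_num => //; exact: (integrableZl measurableT s^-1 ik).
rewrite !EI// -!EFinM -!EFinD lee_fin.
have -> : (forall x, 0 <= H^-1 * h x) <-> True.
  by split=> // _ x; rewrite mulr_ge0 ?invr_ge0 ?(ltW H0)//; exact: kx0.
move=> /(_ I).
have -> : (forall x, M < `|x| -> F^-1 * f x = 0) <-> True.
  by split=> // _ x /bf.2 ->; rewrite mulr0.
move=> /(_ I).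
have -> : (forall x, M < `|x| -> G^-1 * g x = 0) <-> True.
  by split=> // _ x /bg.2 ->; rewrite mulr0.
move=> /(_ I (qk _ _ qf F0) (qk _ _ qg G0) (supk _ F0) (supk _ G0)) key.
have {}key : (1 - l) * (F^-1 * \int[lebesgue_measure]_x f x) +
    l * (G^-1 * \int[lebesgue_measure]_x g x) <= H^-1 * \int[lebesgue_measure]_x h x.
  apply: key => x y.
  have /andP[a0 _] := k01 f F x bf F0 (fF x).
  have /andP[b0 _] := k01 g G y bg G0 (gG y).
  apply: (@le_trans _ _ ((F^-1 * f x) `^ (1 - l) * (G^-1 * g y) `^ l)).
    set a := F^-1 * f x in a0 *; set b := G^-1 * g y in b0 *.
    set m := Num.min a b.
    have m0 : 0 <= m by rewrite le_min a0.
    have -> : m = m `^ (1 - l) * m `^ l.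
      rewrite -powRD ?subrK ?powRr1//.
      by apply/implyP => /eqP; lra.
    have ma : m <= a by rewrite /m ge_min lexx.
    have mb : m <= b by rewrite /m ge_min lexx orbT.
    by apply: ler_pM; rewrite ?powR_ge0//; apply: ge0_ler_powR; rewrite ?nnegrE// ltW.
  rewrite ler_pdivlMl//; apply: le_trans (fgh x y).
  rewrite -[in leRHS](mulVKf (lt0r_neq0 F0) (f x)) -[in leRHS](mulVKf (lt0r_neq0 G0) (g y)).
  by rewrite !(powRM _ (ltW F0)) // !(powRM _ (ltW G0)) // mulrACA.
set A := \int[lebesgue_measure]_x f x in If key *.
set B := \int[lebesgue_measure]_x g x in Ig key *.
have A0 : 0 <= F^-1 * A by rewrite mulr_ge0 ?invr_ge0 ?(ltW F0)//; exact: If0.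
have B0 : 0 <= G^-1 * B by rewrite mulr_ge0 ?invr_ge0 ?(ltW G0)//; exact: If0.
have -> : A `^ (1 - l) * B `^ l = H * ((F^-1 * A) `^ (1 - l) * (G^-1 * B) `^ l).
  by rewrite /H mulrACA -!powRM ?(ltW F0) ?(ltW G0)// !mulVKf ?lt0r_neq0.
rewrite -ler_pdivlMl//; apply: le_trans key; exact: weighted_AMGM.
Qed.

(** * The Prekopa-Leindler inequality in several variables *)

Lemma coord_le_norm (R : realType) n (x : 'rV[R]_n) i : `|x 0 i| <= `|x|.
Proof.
have /mapP[j Hj ->] : `|x 0 i| \in [seq `|x k.1 k.2| | k : 'I_1 * 'I_n].
  by apply/mapP; exists (0, i) => //=; rewrite mem_enum.
by rewrite [leRHS]/Num.norm /= mx_normrE; apply/bigmax_geP; right => /=; exists j.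
Qed.

Lemma norm_le_coord (R : realType) n (x : 'rV[R]_n) r : 0 <= r ->
  (forall i, `|x 0 i| <= r) -> `|x| <= r.
Proof.
move=> r0 xr; rewrite [leLHS]/Num.norm /= mx_normrE; apply/bigmax_leP; split=> //= -[i j] _ /=.
by rewrite (ord1 i).
Qed.

Lemma norm_rV_cons_l (R : realType) n (x : 'rV[R]_n) t : `|x| <= `|rV_cons (x, t)|.
Proof.
by apply: norm_le_coord => // i; rewrite -(rV_consS x t); exact: coord_le_norm.
Qed.

Lemma norm_rV_cons_r (R : realType) n (x : 'rV[R]_n) t : `|t| <= `|rV_cons (x, t)|.
Proof. by rewrite -{1}(rV_cons0 x t); exact: coord_le_norm. Qed.

Lemma rV_cons_conv (R : realType) n (x y : 'rV[R]_n) (s t a b : R) :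
  a *: rV_cons (x, s) + b *: rV_cons (y, t) = rV_cons (a *: x + b *: y, a * s + b * t).
Proof.
apply/rowP => j; rewrite [LHS]mxE [X in X + _]mxE [X in _ + X]mxE.
have [k ->|->] := unliftP ord0 j; last by rewrite !rV_cons0.
by rewrite !rV_consS [RHS]mxE [X in _ = X + _]mxE [X in _ = _ + X]mxE.
Qed.

(** The multiplicative form admits zeros: for exponents strictly between 0 and 1 a zero value makes
    the left-hand side vanish. *)
Definition logconcave (R : realType) (V : lmodType R) (f : V -> R) :=
  forall l x y, 0 < l < 1 -> f x `^ (1 - l) * f y `^ l <= f ((1 - l) *: x + l *: y).

Lemma logconcave_quasiconcave (R : realType) (f : R -> R) : (forall x, 0 <= f x) ->
  logconcave (f : R^o -> R) -> quasiconcave f.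
Proof.
move=> f0 lf x y z /andP[xz zy].
have [->|xz'] := eqVneq z x; first by rewrite ge_min lexx.
have [->|zy'] := eqVneq z y; first by rewrite ge_min lexx orbT.
have {xz xz'}xz : x < z by rewrite lt_neqAle eq_sym xz'.
have {zy zy'}zy : z < y by rewrite lt_neqAle zy'.
pose l := (z - x) / (y - x).
have yx : 0 < y - x by lra.
have l01 : 0 < l < 1 by rewrite divr_gt0 ?ltr_pdivrMr//; lra.
have -> : z = (1 - l) * x + l * y.
  have -> : (1 - l) * x + l * y = x + l * (y - x) by ring.
  by rewrite /l divfK ?lt0r_neq0//; ring.
apply: le_trans (lf l x y l01).
set m := Num.min _ _.
have m0 : 0 <= m by rewrite le_min !f0.
have mx : m <= f x by rewrite /m ge_min lexx.
have my : m <= f y by rewrite /m ge_min lexx orbT.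
have -> : m = m `^ (1 - l) * m `^ l.
  by rewrite -powRD ?subrK ?powRr1//; apply/implyP => /eqP; lra.
by apply: ler_pM; rewrite ?powR_ge0//; apply: ge0_ler_powR; rewrite ?nnegrE//; lra.
Qed.

Section section_integral.
Context (R : realType) (n : nat) (M : R) (f : 'rV[R]_n.+1 -> R).
Hypotheses (mf : measurable_fun setT f) (bf : bsupp M f).

Definition section_integral (x : 'rV[R]_n) : R :=
  \int[lebesgue_measure]_t f (rV_cons (x, t)).

Lemma bsupp_ge0 : 0 <= M.
Proof. by have /andP[h1 h2] := bf.1 0; exact: le_trans h1 h2. Qed.

Lemma bsupp_section x : bsupp M ((fun t => f (rV_cons (x, t))) : R^o -> R).
Proof.
split=> t; first exact: bf.1.
by move=> Mt; apply: bf.2; apply: lt_le_trans Mt _; exact: norm_rV_cons_r.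
Qed.

Lemma measurable_section x : measurable_fun [set: R] (fun t => f (rV_cons (x, t))).
Proof. exact: measurable_rV_cons_section. Qed.

Lemma section_integralE x :
  ((section_integral x)%:E = \int[lebesgue_measure]_t (f (rV_cons (x, t)))%:E)%E.
Proof.
rewrite /section_integral /Rintegral fineK//; apply: integrable_fin_num => //.
by apply: bsupp_integrable1; [exact: bsupp_section|exact: measurable_section].
Qed.

Lemma measurable_section_integral : measurable_fun setT section_integral.
Proof.
apply/measurable_EFinP.
rewrite (_ : EFin \o _ = fun x => \int[lebesgue_measure]_t (f (rV_cons (x, t)))%:E)%E.
  apply: (@measurable_integral_rV_cons _ _ (EFin \o f)); first exact/measurable_EFinP.
  by move=> x /=; rewrite lee_fin; have /andP[] := bf.1 x.
by apply/funext => x /=; rewrite section_integralE.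
Qed.

Lemma bsupp_section_integral :
  bsupp (Num.max M (M * (M *+ 2))) section_integral.
Proof.
have M0 := bsupp_ge0.
split=> [x|x]; last first.
  rewrite gt_max => /andP[Mx _]; rewrite /section_integral /Rintegral integral0_eq// => t _.
  by rewrite bf.2//; apply: lt_le_trans Mx _; exact: norm_rV_cons_l.
rewrite -!lee_fin section_integralE integral_ge0/=; last first.
  by move=> t _; rewrite lee_fin; have /andP[] := bf.1 (rV_cons (x, t)).
rewrite EFin_max le_max; apply/orP; right.
pose B : set (measurableTypeR R) := `[- M, M]%classic.
have mB : measurable B by exact: measurable_itv.
apply: (@le_trans _ _ (\int[lebesgue_measure]_t (M%:E * (\1_B t)%:E))%E).
  apply: ge0_le_integral => //.
  - by move=> t _; rewrite lee_fin; have /andP[] := bf.1 (rV_cons (x, t)).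
  - by apply/measurable_EFinP; exact: measurable_section.
  - by apply: measurable_funeM; apply/measurable_EFinP; exact: measurable_indic.
  - move=> t _; rewrite -EFinM lee_fin indicE.
    have [tB|tB] := boolP (t \in B).
      by rewrite mulr1; have /andP[] := bf.1 (rV_cons (x, t)).
    rewrite mulr0 bf.2// (lt_le_trans _ (norm_rV_cons_r x t))// ltNge.
    apply: contra tB => tM; apply/mem_set.
    by rewrite /B/= in_itv/= -ler_norml.
rewrite ge0_integralZl_EFin//; last first.
  by apply/measurable_EFinP; exact: measurable_indic.
rewrite integral_indic_setT// EFinM; apply: lee_wpmul2l; first by rewrite lee_fin.
rewrite [X in (X <= _)%E](_ : _ = (M *+ 2)%:E)//.
apply: etrans (lebesgue_measure_itv `[- M, M]) _; rewrite /= lte_fin; case: ltP => h.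
  by rewrite -EFinD opprK mulr2n.
congr EFin; have -> : M = 0 by lra.
by rewrite mul0rn.
Qed.

Lemma integral_section_integral :
  \int[lebesgue_rV R n]_x section_integral x = \int[lebesgue_rV R n.+1]_x f x.
Proof.
rewrite /Rintegral (@integral_rVS R n (EFin \o f)); last 2 first.
- exact/measurable_EFinP.
- by move=> x; rewrite lee_fin; have /andP[] := bf.1 x.
by congr fine; apply: eq_integral => x _; rewrite section_integralE.
Qed.

End section_integral.

Lemma le_bsupp (R : realType) (V : normedModType R) (M N : R) (f : V -> R) :
  M <= N -> bsupp M f -> bsupp N f.
Proof.
move=> MN [h1 h2]; split=> x; first by have /andP[-> h] := h1 x; exact: le_trans h MN.
by move=> Nx; apply: h2; exact: le_lt_trans MN Nx.
Qed.

(** Log-concavity of [f] and [g] is carried through the induction: it makes the one-dimensional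
    sections quasiconcave, and it passes to the section integrals by the one-dimensional inequality
    for a function against itself. *)
Lemma prekopa_leindler (R : realType) (n : nat) (f g h : 'rV[R]_n -> R) (M l : R) :
  0 < l < 1 ->
  measurable_fun setT f -> measurable_fun setT g -> measurable_fun setT h ->
  bsupp M f -> bsupp M g -> bsupp M h -> logconcave f -> logconcave g ->
  (forall x y, f x `^ (1 - l) * g y `^ l <= h ((1 - l) *: x + l *: y)) ->
  (\int[lebesgue_rV R n]_x f x) `^ (1 - l) * (\int[lebesgue_rV R n]_x g x) `^ l
    <= \int[lebesgue_rV R n]_x h x.
Proof.
move=> l01; elim: n M f g h => [|n IH] M f g h mf mg mh bf bg bh lf lg fgh.
  have E (k : 'rV[R]_0 -> R) : measurable_fun setT k ->
      \int[lebesgue_rV R 0]_x k x = k 0.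
    move=> mk; rewrite /Rintegral [X in fine X](_ : _ = (k 0)%:E)//.
    rewrite integral_dirac//; last exact/measurable_EFinP.
    by rewrite diracE mem_set// mul1e.
  rewrite !E//; apply: le_trans (fgh 0 0) _.
  by rewrite !scaler0 addr0.
rewrite -(integral_section_integral mf bf) -(integral_section_integral mg bg).
rewrite -(integral_section_integral mh bh).
have pl (u v w : 'rV[R]_n.+1 -> R) (m : R) x y : 0 < m < 1 ->
    measurable_fun setT u -> measurable_fun setT v -> measurable_fun setT w ->
    bsupp M u -> bsupp M v -> bsupp M w -> logconcave u -> logconcave v ->
    (forall x y, u x `^ (1 - m) * v y `^ m <= w ((1 - m) *: x + m *: y)) ->
    section_integral u x `^ (1 - m) * section_integral v y `^ m <=
    section_integral w ((1 - m) *: x + m *: y).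
  move=> m01 mu mv mw bu bv bw lu lv uvw.
  have qs (k : 'rV[R]_n.+1 -> R) z : bsupp M k -> logconcave k ->
      quasiconcave (fun t => k (rV_cons (z, t))).
    move=> bk lk; apply: logconcave_quasiconcave => [t|].
      by have /andP[] := bk.1 (rV_cons (z, t)).
    move=> r s t r01; apply: le_trans (lk r _ _ r01) _.
    by rewrite rV_cons_conv -scalerDl subrK scale1r.
  apply: (@prekopa_leindler1 _ _ _ _ M _ m01) => //; try exact: measurable_section;
    try exact: bsupp_section; try exact: qs.
  by move=> s t; apply: le_trans (uvw _ _) _; rewrite rV_cons_conv.
apply: (IH _ _ _ _
  (measurable_section_integral mf bf) (measurable_section_integral mg bg)
  (measurable_section_integral mh bh) (bsupp_section_integral mf bf)
  (bsupp_section_integral mg bg) (bsupp_section_integral mh bh)).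
- by move=> r x y r01; apply: pl => // x' y'; exact: lf.
- by move=> r x y r01; apply: pl => // x' y'; exact: lg.
- by move=> x y; exact: pl.
Qed.

(** * Powers as integrals of truncated kernels *)

Lemma integral_gt0_itv (R : realType) (f : R -> R) (a b : R) : a < b ->
  measurable_fun setT f -> (forall x, 0 <= f x) ->
  (forall x, a < x < b -> 0 < f x) ->
  (0 < \int[lebesgue_measure]_x (f x)%:E)%E.
Proof.
move=> ab mf f0 fab; rewrite lt_neqAle integral_ge0 ?andbT; last first.
  by move=> x _; rewrite lee_fin.
apply/eqP => I0.
have : (\int[lebesgue_measure]_x `|(f x)%:E| = 0)%E.
  by rewrite I0; apply: eq_integral => x _; rewrite gee0_abs// lee_fin.
have mEf : measurable_fun [set: measurableTypeR R] (EFin \o f) by exact/measurable_EFinP.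
move/(ae_eq_integral_abs lebesgue_measure measurableT mEf) => [N [mN N0 sN]].
have : (lebesgue_measure (`]a, b[%classic : set R) <= lebesgue_measure N)%E.
  apply: le_measure; rewrite ?inE// => x /=; rewrite in_itv/= => xab.
  by apply: sN => /= /(_ I) [] /eqP; rewrite gt_eqF// fab.
rewrite N0 lebesgue_measure_itv/= lte_fin ab -EFinD lee_fin; lra.
Qed.

Lemma max0_le (R : realDomainType) (x : R) : x <= 0 -> Num.max 0 x = 0.
Proof. by move=> x0; apply/max_idPl. Qed.

Section power_kernel.
Context (R : realType).

Lemma one_powR (x : R) : 1 `^ x = 1 :> R. Proof. by rewrite powR1. Qed.

(** Its integral over [r] is a multiple of the power [1 + (e + 1) / k] of the positive part of [y],
    while its mean over a marginal [y] is [r^e * U(r^k)]. For [k = 1/(p-1)], the choices [e = 0] and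
    [e = (q-p)/(p-1)] give the powers [p] and [q]. *)
Definition pker (e k y r : R) : R :=
  if 0 < r then r `^ e * Num.max 0 (y - r `^ k) else 0.

Lemma pker_ge0 (e k y r : R) : 0 <= pker e k y r.
Proof.
by rewrite /pker; case: ifP => // _; rewrite mulr_ge0 ?powR_ge0// le_max lexx.
Qed.

Lemma measurable_pker (e k y : R) : measurable_fun setT (pker e k y).
Proof.
apply: measurable_fun_ifT => //.
  exact: measurable_fun_ltr.
apply: measurable_funM; first exact: measurable_powR.
apply: measurable_maxr => //; apply: measurable_funB => //; exact: measurable_powR.
Qed.

(** Only positivity of this constant matters: it occurs on both sides of each comparison of
    moments. *)
Definition pconst (e k : R) : R := \int[lebesgue_measure]_r pker e k 1 r.

Lemma pker1_bsupp (e k : R) : 0 <= e -> 0 < k -> bsupp 1 (pker e k 1 : R^o -> R).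
Proof.
move=> e0 k0.
suff [h1 h2] : (forall r : R, 0 <= pker e k 1 r <= 1) /\
    (forall r : R, 1 < `|r| -> pker e k 1 r = 0) by split.
split=> r.
  rewrite pker_ge0 /pker/=; case: ifP => [r0|_]; last exact: ler01.
  have [r1|r1] := leP r 1.
    rewrite -[leRHS]mulr1; apply: ler_pM; rewrite ?powR_ge0 ?le_max ?lexx//.
      by rewrite -(one_powR e); apply: ge0_ler_powR; rewrite ?nnegrE ?(ltW r0).
    by rewrite ge_max ler01/= lerBlDr lerDl powR_ge0.
  have h : 1 - r `^ k <= 0.
    by rewrite subr_le0 -(one_powR k); apply: ge0_ler_powR;
      rewrite ?nnegrE ?ler01 ?(ltW r0) ?(ltW r1) ?(ltW k0).
  by rewrite (max0_le h) mulr0 ler01.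
move=> r1; rewrite /pker; case: ifP => // r0; rewrite (gtr0_norm r0) in r1.
have h : 1 - r `^ k <= 0.
  by rewrite subr_le0 -(one_powR k); apply: ge0_ler_powR;
    rewrite ?nnegrE ?ler01 ?(ltW r0) ?(ltW r1) ?(ltW k0).
by rewrite (max0_le h) mulr0.
Qed.

Lemma pconstE (e k : R) : 0 <= e -> 0 < k ->
  (\int[lebesgue_measure]_r (pker e k 1 r)%:E = (pconst e k)%:E)%E.
Proof.
move=> e0 k0; rewrite /pconst /Rintegral fineK//; apply: integrable_fin_num => //.
by apply: bsupp_integrable1; [exact: pker1_bsupp|exact: measurable_pker].
Qed.

Lemma pconst_gt0 (e k : R) : 0 <= e -> 0 < k -> 0 < pconst e k.
Proof.
move=> e0 k0; rewrite -lte_fin -pconstE//.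
apply: (@integral_gt0_itv _ _ 0 1) => //; first exact: measurable_pker.
  by move=> r; exact: pker_ge0.
move=> r /andP[r0 r1]; rewrite /pker r0 mulr_gt0 ?powR_gt0// lt_max subr_gt0.
apply/orP; right; rewrite -(one_powR k).
by apply: gt0_ltr_powR; rewrite ?nnegrE// ltW.
Qed.

Lemma integral_pker (e k y : R) : 0 <= e -> 0 < k ->
  (\int[lebesgue_measure]_r (pker e k y r)%:E =
   (pconst e k * Num.max 0 y `^ (1 + (e + 1) / k))%:E)%E.
Proof.
move=> e0 k0.
have m0 : 0 < 1 + (e + 1) / k by rewrite addr_gt0// divr_gt0//; lra.
have [y0|y0] := leP y 0.
  rewrite powR0 ?lt0r_neq0// mulr0; apply: integral0_eq => r _.
  rewrite /pker; case: ifP => // r0.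
  have h : y - r `^ k <= 0 by rewrite subr_le0 (le_trans y0)// powR_ge0.
  by rewrite (max0_le h) mulr0.
(* The kernel vanishes beyond [a]; the substitution [r = a * t] brings it back to the case
   [y = 1]. *)
pose a := y `^ k^-1.
have a0 : 0 < a by rewrite powR_gt0.
have ak : a `^ k = y by rewrite -powRrM mulVf ?lt0r_neq0// powRr1// ltW.
have mp := measurable_pker e k y.
have := @ge0_integral_affine1 R a 0 (EFin \o pker e k y) a0.
have mEp : measurable_fun [set: R] (EFin \o pker e k y) by exact/measurable_EFinP.
move=> /(_ mEp) sub.
have {}sub := sub (fun r => pker_ge0 e k y r).
have E : (\int[lebesgue_measure]_t (EFin \o pker e k y) (a * t + 0)%R =
    (a `^ e * y)%:E * (pconst e k)%:E)%E.
  rewrite -pconstE// -ge0_integralZl_EFin//; last 3 first.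
  - by move=> r _; rewrite lee_fin pker_ge0.
  - by apply/measurable_EFinP; exact: measurable_pker.
  - by rewrite mulr_ge0 ?powR_ge0// ltW.
  apply: eq_integral => t _ /=; rewrite -EFinM addr0; congr EFin.
  rewrite /pker pmulr_rgt0//; case: ifP => t0; last by rewrite mulr0.
  rewrite !powRM ?(ltW a0) ?(ltW t0)// ak -[X in X - _]mulr1 -mulrBr.
  have -> : Num.max 0 (y * (1 - t `^ k)) = y * Num.max 0 (1 - t `^ k).
    by rewrite maxr_pMr ?ltW// mulr0.
  by ring.
rewrite E in sub.
have -> : (\int[lebesgue_measure]_r (pker e k y r)%:E =
    a%:E * (a^-1%:E * \int[lebesgue_measure]_r (EFin \o pker e k y) r))%E.
  by rewrite muleA -EFinM divff ?lt0r_neq0// mul1e.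
rewrite -sub -!EFinM; congr EFin.
have -> : y `^ (1 + (e + 1) / k) = a * (a `^ e * y).
  have h1 : y `^ ((e + 1) / k) = a `^ (e + 1) by rewrite mulrC powRrM.
  rewrite powRD ?h1; last by apply/implyP => _; rewrite lt0r_neq0.
  rewrite powRD; last by apply/implyP => _; rewrite lt0r_neq0.
  by rewrite !powRr1 ?(ltW a0) ?(ltW y0)//; ring.
by ring.
Qed.

End power_kernel.

(** * Stop-loss transforms and conic transforms *)

(* Concavity of [W]^(1/N) where [W] is positive, stated without roots. *)
Definition root_concave (R : realType) (N : nat) (W : R -> R) :=
  forall s0 s1 a b m, 0 <= m <= 1 -> 0 < a -> 0 < b ->
    a ^+ N <= W s0 -> b ^+ N <= W s1 ->
    ((1 - m) * a + m * b) ^+ N <= W ((1 - m) * s0 + m * s1).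

(** What is retained of the transform of a bounded centered Y: [sl_sub] is convexity with slopes
    between -1 and 0, and [sl_bound] says that Y is bounded with mean 0. The list is stable under
    [flip], so every statement about the right side yields one about the left side. *)
Record stoploss (R : realType) (n : nat) (U : R -> R) := Stoploss {
  sl_ge0 : forall s, 0 <= U s ;
  sl_geN : forall s, 0 <= U s + s ;
  sl_sub : forall t, exists2 a, 0 <= a <= 1 & forall s, U t - a * (s - t) <= U s ;
  sl_root : root_concave n.+1 U ;
  sl_rootN : root_concave n.+1 (fun s => U s + s) ;
  sl_bound : exists B, forall s, B <= s -> U s = 0 /\ U (- s) = s }.

(* [flip U] is the stop-loss transform of -Y when [U] is that of Y. *)
Definition flip (R : realType) (U : R -> R) (s : R) : R := U (- s) - s.

Lemma root_concaveN (R : realType) N (W : R -> R) :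
  root_concave N W -> root_concave N (fun s => W (- s)).
Proof.
move=> rW s0 s1 a b m m01 a0 b0 aW bW.
by have := rW _ _ _ _ _ m01 a0 b0 aW bW; rewrite !mulrN -opprD.
Qed.

Lemma stoploss_flip (R : realType) n (U : R -> R) : stoploss n U -> stoploss n (flip U).
Proof.
case=> U0 UN Us Ur UrN [B UB]; split.
- by move=> s; have := UN (- s); rewrite /flip.
- by move=> s; rewrite /flip subrK.
- move=> t; have [a a01 Ua] := Us (- t); exists (1 - a); first lra.
  by move=> s; have := Ua (- s); rewrite /flip; lra.
- by move=> s0 s1 a b m *; apply: (root_concaveN UrN).
- move=> s0 s1 a b m m01 a0 b0; rewrite /flip !subrK.
  exact: (root_concaveN Ur).
- by exists B => s /UB[h1 h2]; rewrite /flip opprK h1 h2 subrr add0r.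
Qed.

(* [t] is the knot, the common image of all vertices but two; the two truncated
   cones are the contributions of these two vertices. *)
Record conic (R : realType) (n : nat) (U : R -> R) (t x k y j : R) := Conic {
  conic_x0 : 0 <= x ; conic_k0 : 0 <= k ; conic_y0 : 0 <= y ; conic_j0 : 0 <= j ;
  conic_r : forall s, t <= s -> U s = Num.max 0 (x - k * (s - t)) ^+ n.+1 ;
  conic_l : forall s, s <= t -> U s + s = Num.max 0 (y - j * (t - s)) ^+ n.+1 }.

Lemma conic_flip (R : realType) n (U : R -> R) t x k y j :
  conic n U t x k y j -> conic n (flip U) (- t) y j x k.
Proof.
case=> x0 k0 y0 j0 Ur Ul; split=> // s st; rewrite /flip.
  by rewrite Ul; [congr (_ ^+ _); congr Num.max; ring|lra].
by rewrite subrK Ur; [congr (_ ^+ _); congr Num.max; ring|lra].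
Qed.

Lemma nth_root (R : realType) n (u : R) : 0 <= u -> exists2 z, 0 <= z & z ^+ n.+1 = u.
Proof.
move=> u0; exists (u `^ n.+1%:R^-1); first exact: powR_ge0.
by rewrite -powR_mulrn ?powR_ge0// -powRrM mulVf ?powRr1// pnatr_eq0.
Qed.

Lemma nth_root_gt0 (R : realType) n (u : R) : 0 < u -> exists2 z, 0 < z & z ^+ n.+1 = u.
Proof.
move=> u0; have [z z0 zu] := nth_root n (ltW u0); exists z => //.
rewrite lt_neqAle z0 andbT; apply/eqP => z00.
by move: u0; rewrite -zu -z00 expr0n ltxx.
Qed.

Lemma pow_expansion (R : realType) (x d : R) N : exists2 C, 0 <= C &
  forall e, 0 <= e <= 1 ->
    `|(x + e * d) ^+ N - x ^+ N - e * (N%:R * d * x ^+ N.-1)| <= C * e ^+ 2.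
Proof.
elim: N => [|N [C C0 IH]].
  by exists 0 => // e _; rewrite !expr0 subrr !mul0r mulr0 subrr normr0.
exists ((`|x| + `|d|) * C + N%:R * `|d| ^+ 2 * `|x| ^+ N.-1).
  by rewrite addr_ge0 ?mulr_ge0 ?exprn_ge0 ?addr_ge0.
move=> e e01; have := IH e e01; set r := _ - _ - _ => hr.
have -> : (x + e * d) ^+ N.+1 - x ^+ N.+1 - e * (N.+1%:R * d * x ^+ N.+1.-1) =
    (x + e * d) * r + e ^+ 2 * (N%:R * d ^+ 2 * x ^+ N.-1).
  rewrite /r /=; case: N {IH hr r} => [|N] /=; rewrite ?exprS ?expr0; first by ring.
  by rewrite -natr1; ring.
apply: le_trans (ler_normD _ _) _; rewrite [leRHS]mulrDl; apply: lerD.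
  rewrite normrM -[leRHS]mulrA; apply: ler_pM => //.
  apply: le_trans (ler_normD _ _) _; rewrite lerD2l normrM.
  case/andP: e01 => e0 e1; rewrite ger0_norm//.
  by rewrite -[leRHS]mul1r ler_wpM2r.
have /andP[e00 _] := e01.
by rewrite !normrM normr_nat !normrX (ger0_norm e00) mulrC lexx.
Qed.

(** Both sides agree at [e = 0], so their right derivatives there are ordered. The expansion with
    quadratic remainder takes the place of differentiation. *)
Lemma pow_slope (R : realType) (x d c e0 : R) N : 0 < e0 ->
  (forall e, 0 < e < e0 -> x ^+ N + e * c <= (x + e * d) ^+ N) ->
  c <= N%:R * d * x ^+ N.-1.
Proof.
move=> e00 h; rewrite leNgt; apply/negP => gap.
have [C C0 hC] := pow_expansion x d N.
set g := N%:R * d * x ^+ N.-1 in gap hC.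
(* Small enough for the supposed gap [e * (c - g)] to exceed the remainder [C * e ^+ 2]. *)
pose e := Num.min (Num.min 1 e0) ((c - g) / (C + 1)) / 2.
have m0 : 0 < Num.min (Num.min 1 e0) ((c - g) / (C + 1)).
  by rewrite !lt_min ltr01 e00 divr_gt0//; lra.
have e_gt0 : 0 < e by rewrite divr_gt0.
have em : e < Num.min (Num.min 1 e0) ((c - g) / (C + 1)) by rewrite /e; lra.
move: em; rewrite !lt_min => /andP[/andP[e1 ee0]]; rewrite ltr_pdivlMr; last lra.
move=> eC.
have := h e; rewrite e_gt0 ee0 => /(_ isT) h1.
have := hC e; rewrite (ltW e_gt0) (ltW e1) => /(_ isT); rewrite ler_norml => /andP[_ h2].
have : e * (c - g) <= C * e ^+ 2 by lra.
have : C * e ^+ 2 < e * (c - g).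
  by rewrite expr2 mulrA mulrC ltr_pM2l//; have := e_gt0; lra.
lra.
Qed.

Section stoploss_basic.
Context (R : realType) (n : nat) (U : R -> R) (sU : stoploss n U).

Lemma sl_lip s t : s <= t -> U t <= U s <= U t + (t - s).
Proof.
move=> st.
have [a /andP[a0 a1] Ua] := sl_sub sU t; have [b /andP[b0 b1] Ub] := sl_sub sU s.
have h1 := Ua s; have h2 := Ub t.
have h3 : a * (s - t) <= 0 by rewrite mulr_ge0_le0//; lra.
have h4 : b * (t - s) <= t - s by rewrite -[leRHS]mul1r ler_wpM2r//; lra.
by apply/andP; split; lra.
Qed.

(** A concave root lies below its tangent, but [U] need not be differentiable, so any subgradient
    must serve. The chord of the root from [s] through [t] is prolonged to [t - e * (s - t)]:
    concavity bounds the root there by [x + e * (x - z)], the subgradient bounds [U] there from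
    below, and the first-order terms in [e] are compared. *)
Lemma sl_tangent t a x s z : (forall s, U t - a * (s - t) <= U s) ->
  0 < x -> x ^+ n.+1 = U t -> 0 < z -> z ^+ n.+1 <= U s ->
  a * (s - t) <= n.+1%:R * (x - z) * x ^+ n.
Proof.
move=> Ua x0 xU z0 zU.
(* Below [e0] the prolonged value [x + e * (x - z)] is positive. *)
pose e0 := x / (x + z).
have xz0 : 0 < x + z by lra.
apply: (@pow_slope _ x (x - z) (a * (s - t)) e0 n.+1); first exact: divr_gt0.
move=> e /andP[e_gt0 ee0].
have w0 : 0 < x + e * (x - z).
  have : e * (x + z) < x by rewrite -ltr_pdivlMr.
  by have := mulr_gt0 e_gt0 x0; rewrite mulrDr mulrBr; lra.
have tw := Ua (t - e * (s - t)).
apply: (@le_trans _ _ (U (t - e * (s - t)))); first by rewrite xU; lra.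
rewrite leNgt; apply/negP => wU.
have [b b0 bU] : exists2 b, 0 < b & b ^+ n.+1 = U (t - e * (s - t)).
  apply: nth_root_gt0; apply: le_lt_trans wU; exact/exprn_ge0/ltW.
have wb : x + e * (x - z) < b.
  by rewrite -(ltr_pXn2r (_ : 0 < n.+1)%N) ?nnegrE ?ltW// bU.
pose m := e / (1 + e).
have e10 : 0 < 1 + e by lra.
have m01 : 0 <= m <= 1.
  by rewrite divr_ge0 ?ler_pdivrMr ?mul1r//; lra.
have := sl_root sU m01 b0 z0 (_ : b ^+ n.+1 <= U (t - e * (s - t))) zU.
rewrite bU lexx => /(_ isT).
have -> : (1 - m) * (t - e * (s - t)) + m * s = t.
  by rewrite /m; field; rewrite lt0r_neq0.
rewrite -xU ler_pXn2r ?nnegrE ?(ltW x0)//; last first.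
  by rewrite addr_ge0// mulr_ge0 ?(ltW b0) ?(ltW z0)//; lra.
have -> : (1 - m) * b + m * z = (b + e * z) / (1 + e).
  by rewrite /m; field; rewrite lt0r_neq0.
rewrite ler_pdivrMr//; lra.
Qed.

End stoploss_basic.

(** * Comparison of a transform with a conic one *)

Section compare.
Context (R : realType) (n : nat) (U T : R -> R) (t x k y j : R).
Hypotheses (sU : stoploss n U) (sT : stoploss n T) (cT : conic n T t x k y j).

(** Beyond the knot the root of [T] is affine up to truncation, and an affine function below the
    concave root of [U] at two points is below it in between. As [U] is non-increasing, [0 < U s2]
    makes all the roots in question positive. *)
Lemma conic_right s1 s2 s : t <= s1 -> s1 < s2 -> 0 < U s2 ->
  T s1 <= U s1 -> T s2 <= U s2 -> s1 <= s <= s2 -> T s <= U s.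
Proof.
move=> ts1 s12 U2 TU1 TU2 /andP[s1s ss2].
have U1 : 0 < U s1 by apply: lt_le_trans U2 _; case/andP: (sl_lip sU (ltW s12)).
have [z1 z10 z1U] := nth_root_gt0 n U1; have [z2 z20 z2U] := nth_root_gt0 n U2.
have L r z : t <= r -> 0 < z -> z ^+ n.+1 = U r -> T r <= U r -> x - k * (r - t) <= z.
  move=> tr z0 <-; rewrite (conic_r cT tr) ler_pXn2r ?nnegrE ?le_max ?lexx ?(ltW z0)//.
  by rewrite ge_max => /andP[].
have L1 := L _ _ ts1 z10 z1U TU1.
have L2 := L _ _ (le_trans ts1 (ltW s12)) z20 z2U TU2.
pose m := (s - s1) / (s2 - s1).
have s21 : 0 < s2 - s1 by lra.
have m01 : 0 <= m <= 1 by rewrite divr_ge0 ?ler_pdivrMr ?mul1r//; lra.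
have sm : (1 - m) * s1 + m * s2 = s by rewrite /m; field; rewrite lt0r_neq0.
have := sl_root sU m01 z10 z20 (_ : z1 ^+ n.+1 <= U s1) (_ : z2 ^+ n.+1 <= U s2).
rewrite z1U z2U !lexx sm => /(_ isT isT); apply: le_trans.
rewrite (conic_r cT (le_trans ts1 s1s)).
have m'0 : 0 <= 1 - m by lra.
have m0 : 0 <= m by lra.
have zz0 : 0 <= (1 - m) * z1 + m * z2.
  by rewrite addr_ge0// mulr_ge0// ltW.
rewrite lerXn2r ?nnegrE ?le_max ?lexx// ge_max zz0 /= -sm.
have := ler_wpM2l m'0 L1; have := ler_wpM2l m0 L2; lra.
Qed.

(** Strictness at the right end alone spreads to every point after [s1]; this gives the strict
    inequality of integrals behind [kint_extreme]. *)
Lemma conic_right_lt s1 s2 s : t <= s1 -> s1 < s2 -> 0 < U s2 ->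
  T s1 <= U s1 -> T s2 < U s2 -> s1 < s <= s2 -> T s < U s.
Proof.
move=> ts1 s12 U2 TU1 TU2 /andP[s1s ss2].
have U1 : 0 < U s1 by apply: lt_le_trans U2 _; case/andP: (sl_lip sU (ltW s12)).
have [z1 z10 z1U] := nth_root_gt0 n U1; have [z2 z20 z2U] := nth_root_gt0 n U2.
have L1 : x - k * (s1 - t) <= z1.
  move: TU1; rewrite -z1U (conic_r cT ts1) ler_pXn2r ?nnegrE ?le_max ?lexx ?(ltW z10)//.
  by rewrite ge_max => /andP[].
have L2 : x - k * (s2 - t) < z2.
  move: TU2; rewrite -z2U (conic_r cT (le_trans ts1 (ltW s12))).
  rewrite ltr_pXn2r ?nnegrE ?le_max ?lexx ?(ltW z20)//.
  by rewrite gt_max => /andP[].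
pose m := (s - s1) / (s2 - s1).
have s21 : 0 < s2 - s1 by lra.
have m0 : 0 < m by rewrite divr_gt0//; lra.
have m01 : 0 <= m <= 1 by rewrite (ltW m0) ler_pdivrMr ?mul1r//; lra.
have sm : (1 - m) * s1 + m * s2 = s by rewrite /m; field; rewrite lt0r_neq0.
have := sl_root sU m01 z10 z20 (_ : z1 ^+ n.+1 <= U s1) (_ : z2 ^+ n.+1 <= U s2).
rewrite z1U z2U !lexx sm => /(_ isT isT); apply: lt_le_trans.
rewrite (conic_r cT (le_trans ts1 (ltW s1s))).
have m'0 : 0 <= 1 - m by lra.
have zz0 : 0 < (1 - m) * z1 + m * z2.
  by apply: ltr_wpDl; [rewrite mulr_ge0// ltW|rewrite mulr_gt0].
rewrite ltr_pXn2r ?nnegrE ?le_max ?lexx ?(ltW zz0)// gt_max zz0 /= -sm.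
have := ler_wpM2l m'0 L1; have : m * (x - k * (s2 - t)) < m * z2 by rewrite ltr_pM2l.
lra.
Qed.

(* At the knot, the subgradient [b] of [T] bounds the slope of its conic part,
   while the subgradient [a] of [U] bounds [U] by its tangent cone. *)
Lemma conic_cross a b s : 0 <= a -> b <= a ->
  (forall s, U t - a * (s - t) <= U s) -> (forall s, T t - b * (s - t) <= T s) ->
  U t < T t -> t < s -> 0 < U s -> U s < T s.
Proof.
move=> a0 ba Ua Tb UT ts Us0.
have Ut0 : 0 < U t by apply: lt_le_trans Us0 _; case/andP: (sl_lip sU (ltW ts)).
have [u u0 uU] := nth_root_gt0 n Ut0; have [z z0 zU] := nth_root_gt0 n Us0.
have tan : a * (s - t) <= n.+1%:R * (u - z) * u ^+ n.
  by apply: (sl_tangent sU Ua u0 uU z0); rewrite zU.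
have Tt : T t = x ^+ n.+1.
  by rewrite (conic_r cT (lexx t)) subrr mulr0 subr0; congr (_ ^+ _); apply/max_idPr; exact: conic_x0 cT.
have x0 := conic_x0 cT; have k0 := conic_k0 cT.
have ux : u < x.
  by rewrite -(ltr_pXn2r (_ : 0 < n.+1)%N) ?nnegrE ?(ltW u0)// uU -Tt.
have xx0 : 0 < x by lra.
(* The right derivative of [T] at the knot is at least the subgradient [-b]; the bound [x / (k + 1)]
   on the increment keeps the cone away from its truncation. *)
have kb : - b <= n.+1%:R * (- k) * x ^+ n.
  apply: (@pow_slope _ x (- k) (- b) (x / (k + 1)) n.+1).
    by rewrite divr_gt0//; lra.
  move=> e /andP[e0]; rewrite ltr_pdivlMr; last lra.
  move=> ek; have := Tb (t + e).
  have te : t <= t + e by rewrite lerDl ltW.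
  rewrite (conic_r cT te) Tt.
  have -> : Num.max 0 (x - k * (t + e - t)) = x + e * - k.
    have -> : x - k * (t + e - t) = x + e * - k by ring.
    by apply/max_idPr; have := mulr_ge0 (ltW e0) k0; lra.
  have -> : t + e - t = e by ring.
  by have -> : e * - b = - (b * e) by ring.
set D := s - t in tan *; have D0 : 0 < D by rewrite /D; lra.
have uz : 0 <= u - z.
  have : 0 <= n.+1%:R * (u - z) * u ^+ n by apply: le_trans tan; rewrite mulr_ge0 ?(ltW D0).
  by rewrite pmulr_lge0 ?exprn_gt0// pmulr_rge0// ltr0n.
have nx : 0 < n.+1%:R * x ^+ n :> R by rewrite mulr_gt0 ?exprn_gt0// ltr0n.
have kD : k * D <= u - z.
  rewrite -(ler_pM2l nx); apply: (@le_trans _ _ (n.+1%:R * (u - z) * u ^+ n)).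
    apply: le_trans tan; rewrite mulrA; apply: ler_wpM2r; first exact: ltW.
    by apply: le_trans ba; rewrite mulrAC; rewrite mulrN mulNr lerN2 in kb.
  rewrite mulrAC; apply: ler_wpM2r => //; apply: ler_wpM2l => //.
  by rewrite lerXn2r ?nnegrE ?(ltW u0)// ltW.
rewrite -zU (conic_r cT (ltW ts)) ltr_pXn2r ?nnegrE ?le_max ?lexx ?(ltW z0)//.
by rewrite lt_max; apply/orP; right; rewrite -/D; lra.
Qed.

End compare.

Lemma conic_left (R : realType) (n : nat) (U T : R -> R) (t x k y j s1 s2 s : R) :
  stoploss n U -> stoploss n T -> conic n T t x k y j ->
  s2 <= t -> s1 < s2 -> 0 < U s1 + s1 ->
  T s1 <= U s1 -> T s2 <= U s2 -> s1 <= s <= s2 -> T s <= U s.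
Proof.
move=> sU sT cT s2t s12 U1 TU1 TU2 /andP[s1s ss2].
have fE (W : R -> R) r : flip W (- r) = W r + r by rewrite /flip opprK.
have := @conic_right R n (flip U) (flip T) (- t) y j x k (stoploss_flip sU)
  (conic_flip cT) (- s2) (- s1) (- s).
by rewrite !fE !lerD2r; apply=> //; lra.
Qed.

(** The positivity hypotheses place [s1] and [s2] strictly inside the range of Y. When the knot lies
    between them, the inequality at the knot is what allows the two one-sided comparisons to be
    joined. *)
Lemma stoploss_pattern (R : realType) (n : nat) (U T : R -> R) (t x k y j s1 s2 s : R) :
  stoploss n U -> stoploss n T -> conic n T t x k y j ->
  s1 < s2 -> 0 < U s1 + s1 -> 0 < U s2 -> T s1 <= U s1 -> T s2 <= U s2 ->
  s1 <= s <= s2 -> T s <= U s.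
Proof.
move=> sU sT cT s12 V1 U2 TU1 TU2 sin.
have [ts1|s1t] := leP t s1; first exact: (conic_right sU cT ts1 s12).
have [s2t|ts2] := leP s2 t; first exact: (conic_left sU sT cT s2t s12).
have TUt : T t <= U t.
  rewrite leNgt; apply/negP => UT.
  have [a /andP[a0 a1] Ua] := sl_sub sU t; have [b /andP[b0 b1] Tb] := sl_sub sT t.
  (* If [b <= a], the inequality at [s2] is contradicted. Otherwise the flipped functions have
     subgradients [-(1 - a)] and [-(1 - b)] at [-t], in the order that contradicts the inequality at
     [s1]. *)
  have [ba|ab] := leP b a.
    by have := conic_cross sU cT a0 ba Ua Tb UT ts2 U2; rewrite ltNge TU2.
  have fE (W : R -> R) r : flip W (- r) = W r + r by rewrite /flip opprK.
  have := @conic_cross R n (flip U) (flip T) (- t) y j x k (stoploss_flip sU)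
    (conic_flip cT) (1 - a) (1 - b) (- s1).
  rewrite !fE !ltrD2r (ltNge _ (T s1)) TU1 /= => H.
  suff : false by [].
  apply: H => //; try lra.
    by move=> r; rewrite /flip; have := Ua (- r); lra.
  by move=> r; rewrite /flip; have := Tb (- r); lra.
case/andP: sin => s1s ss2; have [tsl|tsg] := leP t s.
  by apply: (conic_right sU cT (lexx t) ts2 U2 TUt TU2); rewrite tsl.
by apply: (conic_left sU sT cT (lexx t) s1t V1 TU1 TUt); rewrite s1s ltW.
Qed.

(** * Weighted integrals and changes of sign *)

(* With k = 1/(p-1), the substitution s = r^k turns the weight s^(p-2), singular
   at 0 when p < 2, into a constant, and s^(q-2) into r^((q-p)/(p-1)). *)
Definition kfun (R : realType) (e k : R) (U : R -> R) (r : R) : R :=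
  if 0 < r then r `^ e * U (r `^ k) else 0.

Definition kint (R : realType) (e k : R) (U : R -> R) : \bar R :=
  (\int[lebesgue_measure]_r (kfun e k U r)%:E)%E.

Lemma measurable_nonincreasing (R : realType) (U : R -> R) :
  {homo U : x y /~ x <= y} -> measurable_fun setT U.
Proof.
move=> hU; apply: (measurability (@RGenOInfty.G R)) => [|_ [_ [a ->] <-]].
  exact: RGenOInfty.measurableE.
rewrite setTI; apply: is_interval_measurable => x y /=.
rewrite !in_itv/= !andbT => ax ay z /andP[xz zy].
by rewrite in_itv/= andbT; apply: lt_le_trans ay _; exact: hU.
Qed.

Section kint_compare.
Context (R : realType) (n : nat).
Implicit Types (U T : R -> R) (e k : R).

Lemma measurable_stoploss U : stoploss n U -> measurable_fun setT U.
Proof.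
move=> sU; apply: measurable_nonincreasing => y x yx.
by case/andP: (sl_lip sU yx).
Qed.

Lemma measurable_kfun U e k : measurable_fun setT U -> measurable_fun setT (kfun e k U).
Proof.
move=> mU; apply: measurable_fun_ifT => //; first exact: measurable_fun_ltr.
apply: measurable_funM; first exact: measurable_powR.
by apply: measurableT_comp => //; exact: measurable_powR.
Qed.

Lemma kfun_ge0 U e k r : (forall s, 0 <= U s) -> 0 <= kfun e k U r.
Proof. by move=> U0; rewrite /kfun; case: ifP => // _; rewrite mulr_ge0 ?powR_ge0. Qed.

Lemma kint_lt U T k eta : 0 < k -> 0 < eta ->
  measurable_fun setT U -> measurable_fun setT T ->
  (forall s, 0 <= U s) -> (forall s, 0 <= T s) ->
  (forall s, 0 < s -> U s <= T s) -> (forall s, 0 < s < eta -> U s < T s) ->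
  (kint 0%R k U < +oo)%E -> (kint 0%R k U < kint 0%R k T)%E.
Proof.
move=> k0 eta0 mU mT U0 T0 UT UTlt Uoo.
pose D r : R := if 0 < r then kfun 0 k T r - kfun 0 k U r else 0.
have kf W r : 0 < r -> kfun 0 k W r = W (r `^ k).
  by move=> r0; rewrite /kfun r0 powRr0 mul1r.
have D0 r : 0 <= D r.
  rewrite /D; case: ifP => // r0; rewrite !kf// subr_ge0 UT// powR_gt0//.
have mkU := measurable_kfun 0 k mU; have mkT := measurable_kfun 0 k mT.
have mD : measurable_fun setT D.
  apply: measurable_fun_ifT => //; first exact: measurable_fun_ltr.
  exact: measurable_funB.
have E : (\int[lebesgue_measure]_r (kfun 0 k U r + D r)%:E <= kint 0%R k T)%E.
  apply: ge0_le_integral => //.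
  - by move=> r _; rewrite lee_fin addr_ge0// kfun_ge0.
  - by apply/measurable_EFinP; exact: measurable_funD.
  - exact/measurable_EFinP.
  - move=> r _; rewrite lee_fin /D; case: ifP => r0; first by rewrite subrKC.
    by rewrite addr0 /kfun r0.
apply: lt_le_trans E.
under eq_integral do rewrite EFinD.
rewrite ge0_integralD//; last 4 first.
- by move=> r _; rewrite lee_fin kfun_ge0.
- exact/measurable_EFinP.
- by move=> r _; rewrite lee_fin.
- exact/measurable_EFinP.
rewrite lteDl; last first.
  by rewrite ge0_fin_numE// integral_ge0// => r _; rewrite lee_fin kfun_ge0.
apply: (@integral_gt0_itv _ _ 0 (eta `^ k^-1)) => //; first by rewrite powR_gt0.
move=> r /andP[r0 re]; rewrite /D r0 !kf// subr_gt0; apply: UTlt.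
rewrite powR_gt0//=.
have -> : eta = (eta `^ k^-1) `^ k by rewrite -powRrM mulVf ?lt0r_neq0// powRr1// ltW.
by apply: gt0_ltr_powR; rewrite ?nnegrE ?powR_ge0// ltW.
Qed.

Lemma stoploss_near0 U s : stoploss n U -> 0 < s < U 0 -> 0 < U s.
Proof.
by move=> sU /andP[s0 sU0]; have /andP[] := sl_lip sU (ltW s0); lra.
Qed.

Lemma stoploss_flip0 U : flip U 0 = U 0.
Proof. by rewrite /flip oppr0 addr0. Qed.

(** Otherwise [T] exceeds [U] wherever [U] is positive on the half line, in particular on []0, U 0[]
    because [U] is 1-Lipschitz, and the two integrals could not be equal. *)
Lemma stoploss_touch U T k : 0 < k -> stoploss n U -> stoploss n T -> 0 < U 0 ->
  kint 0%R k T = kint 0%R k U -> (kint 0%R k U < +oo)%E ->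
  exists s, [/\ 0 < s, 0 < U s & T s <= U s].
Proof.
move=> k0 sU sT U0 IE Ioo; apply: contrapT => nex.
have key s : 0 < s -> 0 < U s -> U s < T s.
  by move=> s0 Us; rewrite ltNge; apply/negP => TU; apply: nex; exists s.
have := @kint_lt U T k (U 0) k0 U0 (measurable_stoploss sU) (measurable_stoploss sT)
  (sl_ge0 sU) (sl_ge0 sT).
rewrite IE ltxx => H; suff : false by [].
apply: H => // s; last by move=> s0; have /andP[h1 _] := s0; apply: key h1 (stoploss_near0 sU s0).
move=> s0; have := sl_ge0 sU s; rewrite le_eqVlt => /orP[/eqP <-|]; first exact: sl_ge0 sT s.
by move=> /(key _ s0)/ltW.
Qed.

Lemma kint_compare U T t x k y j e K : 0 < K -> 0 <= e ->
  stoploss n U -> stoploss n T -> conic n T t x k y j -> 0 < U 0 ->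
  kint 0%R K T = kint 0%R K U -> (kint 0%R K U < +oo)%E ->
  kint 0%R K (flip T) = kint 0%R K (flip U) -> (kint 0%R K (flip U) < +oo)%E ->
  (kint e K U <= kint e K T)%E.
Proof.
move=> K0 e0 sU sT cT U0 IE Ioo IEf Ifoo.
(* Equality on the negative half line yields the left anchor [-s1] of the interval on which
   [T <= U]. *)
have [s1 [s10 V1 TU1]] : exists s, [/\ 0 < s, 0 < flip U s & flip T s <= flip U s].
  apply: (stoploss_touch K0 (stoploss_flip sU) (stoploss_flip sT)) => //.
  by rewrite stoploss_flip0.
pose E := [set s | [/\ 0 < s, 0 < U s & T s <= U s]].
have E0 : E !=set0.
  by have [s Es] := stoploss_touch K0 sU sT U0 IE Ioo; exists s.
have [B UB] := sl_bound sU.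
have Eub : has_ubound E.
  exists B => s [s0 Us _]; rewrite leNgt; apply/negP => Bs.
  by have [] := UB s (ltW Bs); lra.
(* The place where [T - U] changes sign: before it, [T <= U] by the interval property from [-s1];
   after it, a point with [T < U] would have [U > 0] and belong to [E]. *)
pose sg := sup E.
have sg0 : 0 < sg.
  have [s Es] := E0; apply: lt_le_trans (_ : s <= _); first by case: Es.
  exact: ub_le_sup.
have below s : 0 < s < sg -> T s <= U s.
  move=> /andP[s0 ssg].
  have [s2 [s20 Us2 TU2] ss2] : exists2 s2, E s2 & s < s2 by exact: sup_gt.
  apply: (@stoploss_pattern R n U T t x k y j (- s1) s2 s) => //; first lra.
    by move: TU1; rewrite /flip lerD2r.
  by apply/andP; split; lra.
have above s : sg < s -> U s <= T s.
  move=> sgs; rewrite leNgt; apply/negP => TU.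
  have : E s by split; [lra|exact: le_lt_trans (sl_ge0 sT s) TU|exact: ltW].
  by move/(ub_le_sup Eub); rewrite -/sg; lra.
pose rho := sg `^ K^-1.
have rho0 : 0 < rho by rewrite powR_gt0.
have rhoK : rho `^ K = sg by rewrite -powRrM mulVf ?lt0r_neq0// powRr1// ltW.
(* This is [(r^e - rho^e) * (T - U) >= 0] at [r^K], rearranged so that both sides are non-negative
   and can be integrated with values in the extended reals. *)
have pw r : kfun e K U r + rho `^ e * kfun 0 K T r <=
    kfun e K T r + rho `^ e * kfun 0 K U r.
  rewrite /kfun; case: ifP => r0; last by rewrite !mulr0.
  rewrite powRr0 !mul1r.
  have [rr|rr] := leP r rho.
    have h1 : r `^ e <= rho `^ e by apply: ge0_ler_powR; rewrite ?nnegrE// ltW.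
    have [<-|rne] := eqVneq r rho; first by rewrite addrC.
    have h2 : T (r `^ K) <= U (r `^ K).
      apply: below; rewrite powR_gt0//= -rhoK gt0_ltr_powR ?nnegrE//; try exact: ltW.
      by rewrite lt_neqAle rne.
    rewrite -subr_ge0 (_ : _ - _ = (rho `^ e - r `^ e) * (U (r `^ K) - T (r `^ K))).
      by rewrite mulr_ge0// subr_ge0.
    by ring.
  have h1 : rho `^ e <= r `^ e by apply: ge0_ler_powR; rewrite ?nnegrE// ltW.
  have h2 : U (r `^ K) <= T (r `^ K).
    by apply: above; rewrite -rhoK gt0_ltr_powR ?nnegrE//; exact: ltW.
  rewrite -subr_ge0 (_ : _ - _ = (r `^ e - rho `^ e) * (T (r `^ K) - U (r `^ K))).
    by rewrite mulr_ge0// subr_ge0.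
  by ring.
have mk W d : stoploss n W -> measurable_fun setT (kfun d K W).
  by move=> sW; apply: measurable_kfun; exact: measurable_stoploss.
have k0 W d r : stoploss n W -> 0 <= kfun d K W r.
  by move=> sW; apply: kfun_ge0; exact: (sl_ge0 sW).
have c0 : 0 <= rho `^ e by exact: powR_ge0.
have split W W' : stoploss n W -> stoploss n W' ->
    (\int[lebesgue_measure]_r (kfun e K W r + rho `^ e * kfun 0 K W' r)%:E =
     kint e K W + (rho `^ e)%:E * kint 0%R K W')%E.
  move=> sW sW'; under eq_integral do rewrite EFinD EFinM.
  rewrite ge0_integralD//; last 4 first.
  - by move=> r _; rewrite lee_fin k0.
  - by apply/measurable_EFinP; exact: mk.
  - by move=> r _; rewrite mule_ge0// lee_fin k0.
  - by apply: measurable_funeM; apply/measurable_EFinP; exact: mk.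
  rewrite ge0_integralZl_EFin//; first by move=> r _; rewrite lee_fin k0.
  by apply/measurable_EFinP; exact: mk.
have : (kint e K U + (rho `^ e)%:E * kint 0%R K T <=
        kint e K T + (rho `^ e)%:E * kint 0%R K U)%E.
  rewrite -!split//; apply: ge0_le_integral => //.
  - by move=> r _; rewrite lee_fin addr_ge0 ?mulr_ge0 ?k0.
  - by apply/measurable_EFinP; apply: measurable_funD; [exact: mk|apply: measurable_funM => //; exact: mk].
  - by apply/measurable_EFinP; apply: measurable_funD; [exact: mk|apply: measurable_funM => //; exact: mk].
  by move=> r _; rewrite lee_fin; exact: pw.
rewrite IE leeD2rE// fin_numM// ge0_fin_numE//.
by apply: integral_ge0 => r _; rewrite lee_fin k0.
Qed.

(** With [y = j = 0] the law of [T] has no mass below the knot, so [T t = - t] is the least value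
    possible and [T <= U] at the knot. If [T < U] at some positive point, affine comparison from the
    knot gives [T <= U] on the whole negative half line, strictly near 0, against the equality of
    the flipped integrals. *)
Lemma kint_extreme U T t x k K : 0 < K ->
  stoploss n U -> stoploss n T -> conic n T t x k 0 0 -> 0 < U 0 ->
  kint 0%R K (flip T) = kint 0%R K (flip U) -> (kint 0%R K (flip U) < +oo)%E ->
  (kint 0%R K U <= kint 0%R K T)%E.
Proof.
move=> K0 sU sT cT U0 IEf Ifoo.
have Tl s : s <= t -> T s = - s.
  move=> st; have := conic_l cT st.
  by rewrite mul0r subr0 maxxx expr0n/= => /eqP; rewrite addr_eq0 => /eqP.
have [[s2 [s20 TU2]]|nex] := pselect (exists s2, 0 < s2 /\ T s2 < U s2); last first.
  apply: ge0_le_integral => //.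
  - by move=> r _; rewrite lee_fin kfun_ge0//; exact: (sl_ge0 sU).
  - by apply/measurable_EFinP; apply: measurable_kfun; exact: measurable_stoploss.
  - by apply/measurable_EFinP; apply: measurable_kfun; exact: measurable_stoploss.
  move=> r _; rewrite lee_fin /kfun; case: ifP => // r0.
  rewrite powRr0 !mul1r leNgt; apply/negP => h; apply: nex.
  by exists (r `^ K); rewrite powR_gt0.
have Us2 : 0 < U s2 by apply: le_lt_trans TU2; exact: (sl_ge0 sT s2).
have TUt : T t <= U t.
  by have := sl_geN sU t; have := Tl t (lexx t); lra.
have t0 : t <= 0 by have := sl_ge0 sT t; rewrite Tl// oppr_ge0.
have strict s : 0 < s < U 0 -> flip T s < flip U s.
  move=> /andP[s0 sU0]; rewrite /flip ltrD2r.
  have [st|ts] := leP (- s) t.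
    have ms : - s <= 0 by lra.
    by rewrite Tl//; have /andP[] := sl_lip sU ms; lra.
  by apply: (conic_right_lt sU cT (lexx t) _ Us2 TUt TU2); lra.
have weak s : 0 < s -> flip T s <= flip U s.
  move=> s0; rewrite /flip lerD2r; have [st|ts] := leP (- s) t.
    by rewrite Tl//; have := sl_geN sU (- s); lra.
  by apply: ltW; apply: (conic_right_lt sU cT (lexx t) _ Us2 TUt TU2); lra.
have sUf := stoploss_flip sU; have sTf := stoploss_flip sT.
have := kint_lt K0 U0 (measurable_stoploss sTf) (measurable_stoploss sUf)
  (sl_ge0 sTf) (sl_ge0 sUf) weak strict.
by rewrite IEf ltxx => /(_ Ifoo).
Qed.

End kint_compare.

(** * Averages over a convex body *)

Section mean.
Context (R : realType) (n : nat) (K : convex_body R n).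
Let leb := lebesgue_rV R n.
Let mK := measurable_convex_body K.
Local Notation S := (convex_body_set K).

Lemma convex_body_bounded : exists2 B : R, 0 < B & forall x, S x -> `|x| <= B.
Proof.
have [M [_ MK]] := @compact_bounded R _ S (@convex_body_compact _ _ K).
exists (Num.max 1 (M + 1)); first by rewrite lt_max ltr01.
by move=> x Kx; apply: (MK _ _ x Kx); rewrite lt_max ltrDl ltr01 orbT.
Qed.

Lemma convex_body_vol_lty : (leb K < +oo)%E.
Proof.
have [B B0 KB] := convex_body_bounded.
apply: (@le_lt_trans _ _ (leb (ball 0 (B + 1)))).
  apply: le_measure; rewrite ?inE//; first exact: measurable_ball_rV.
  by move=> x /KB xB; rewrite -ball_normE/= sub0r normrN; lra.
by rewrite lebesgue_rV_ball ?ltry//; lra.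
Qed.

Lemma convex_body_ball : exists x r, 0 < r /\ ball x r `<=` (K : set 'rV[R]_n).
Proof.
have [x Kx] := @convex_body_interior _ _ K.
by move: Kx => /nbhs_ballP[r /= r0 rK]; exists x, r.
Qed.

Lemma convex_body_vol_gt0 : (0 < leb K)%E.
Proof.
have [x [r [r0 rK]]] := convex_body_ball.
apply: (@lt_le_trans _ _ (leb (ball x r))).
  by rewrite lebesgue_rV_ball// lte_fin exprn_gt0// mulrn_wgt0.
by apply: le_measure; rewrite ?inE//; exact: measurable_ball_rV.
Qed.

Definition volr : R := fine (leb K).

Lemma volr_gt0 : 0 < volr.
Proof. by rewrite fine_gt0// convex_body_vol_gt0 convex_body_vol_lty. Qed.

Lemma volrE : leb K = volr%:E.
Proof. by rewrite fineK// ge0_fin_numE// convex_body_vol_lty. Qed.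

(** Boundedness is asked on the body only, so that coordinates and linear functionals qualify. *)
Definition bmfun (f : 'rV[R]_n -> R) :=
  measurable_fun setT f /\ exists M, forall x, S x -> `|f x| <= M.

Lemma bmfun_integrable f : bmfun f -> leb.-integrable K (EFin \o f).
Proof.
case=> mf [M fM]; apply: (integrable_bounded_on mK convex_body_vol_lty _ fM).
exact: measurable_funTS.
Qed.

(** The expectation under the uniform law as a real integral over the body; [integral_uniform]
    relates the two for non-negative functions. *)
Definition mean (f : 'rV[R]_n -> R) : R := volr^-1 * \int[leb]_(x in K) f x.

Lemma bmfunD f g : bmfun f -> bmfun g -> bmfun (fun x => f x + g x).
Proof.
move=> [mf [M fM]] [mg [N gN]]; split; first exact: measurable_funD.
exists (M + N) => x Kx; apply: le_trans (ler_normD _ _) _.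
by apply: lerD; [exact: fM|exact: gN].
Qed.

Lemma bmfun_cst c : bmfun (fun=> c).
Proof. by split; [exact: measurable_cst|exists `|c|]. Qed.

Lemma bmfunM f g : bmfun f -> bmfun g -> bmfun (fun x => f x * g x).
Proof.
move=> [mf [M fM]] [mg [N gN]]; split; first exact: measurable_funM.
exists (M * N) => x Kx; rewrite normrM; apply: ler_pM => //; [exact: fM|exact: gN].
Qed.

Lemma bmfunZ c f : bmfun f -> bmfun (fun x => c * f x).
Proof. by apply: bmfunM; exact: bmfun_cst. Qed.

Lemma bmfun_max0 f : bmfun f -> bmfun (fun x => Num.max 0 (f x)).
Proof.
move=> [mf [M fM]]; split; first by apply: measurable_maxr => //; exact: measurable_cst.
exists M => x /fM h; apply: le_trans h.
rewrite ger0_norm ?le_max ?lexx// ge_max normr_ge0/=; exact: ler_norm.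
Qed.

Lemma bmfun_powR f p : 0 <= p -> bmfun f -> (forall x, 0 <= f x) -> bmfun (fun x => f x `^ p).
Proof.
move=> p0 [mf [M fM]] f0; split.
  exact: (measurableT_comp (measurable_powR p) mf).
exists (M `^ p) => x Kx; rewrite ger0_norm ?powR_ge0//.
have h := fM x Kx; apply: ge0_ler_powR; rewrite ?nnegrE//.
  exact: le_trans (normr_ge0 _) h.
exact: le_trans (ler_norm _) h.
Qed.

Lemma bmfun_norm f : bmfun f -> bmfun (fun x => `|f x|).
Proof.
move=> [mf [M fM]]; split; first by apply: measurableT_comp => //; exact: measurable_normr.
by exists M => x /fM; rewrite normr_id.
Qed.

Lemma measurable_dot (th : 'rV[R]_n) : measurable_fun setT (fun x : 'rV[R]_n => dot x th).
Proof.
rewrite /dot; elim: (index_enum _) => [|i r IH].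
  by under eq_fun do rewrite big_nil; exact: measurable_cst.
under eq_fun do rewrite big_cons; apply: measurable_funD => //.
by apply: measurable_funM => //; exact: measurable_coord.
Qed.

Lemma bmfun_dot th : bmfun (fun x => dot x th).
Proof.
split; first exact: measurable_dot.
have [B B0 KB] := convex_body_bounded.
exists (\sum_i B * `|th 0 i|) => x /KB xB; apply: le_trans (ler_norm_sum _ _ _) _.
apply: ler_sum => i _; rewrite normrM ler_wpM2r//.
exact: le_trans (coord_le_norm _ _) xB.
Qed.

Lemma bmfun_dotB th s : bmfun (fun x => dot x th - s).
Proof. by apply: bmfunD; [exact: bmfun_dot|exact: bmfun_cst]. Qed.

Lemma mean_le f g : bmfun f -> bmfun g -> (forall x, S x -> f x <= g x) ->
  mean f <= mean g.
Proof.
move=> bf bg fg; rewrite ler_pM2l ?invr_gt0 ?volr_gt0//.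
by apply: le_Rintegral => //; exact: bmfun_integrable.
Qed.

Lemma mean_eq f g : (forall x, S x -> f x = g x) -> mean f = mean g.
Proof.
by move=> fg; congr (_ * _); apply: eq_Rintegral => x /set_mem; exact: fg.
Qed.

Lemma meanD f g : bmfun f -> bmfun g -> mean (fun x => f x + g x) = mean f + mean g.
Proof.
move=> bf bg; rewrite /mean RintegralD//; try exact: bmfun_integrable.
by rewrite mulrDr.
Qed.

Lemma meanZ c f : bmfun f -> mean (fun x => c * f x) = c * mean f.
Proof.
move=> bf; rewrite /mean RintegralZl//; last exact: bmfun_integrable.
by rewrite mulrCA.
Qed.

Lemma mean_cst c : mean (fun=> c) = c.
Proof.
by rewrite /mean Rintegral_cst// -/volr mulrC mulfK// lt0r_neq0// volr_gt0.
Qed.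

Lemma mean_ge0 f : (forall x, S x -> 0 <= f x) -> 0 <= mean f.
Proof.
move=> f0; rewrite mulr_ge0 ?invr_ge0 ?(ltW volr_gt0)//; exact: Rintegral_ge0.
Qed.

Lemma meanE f : bmfun f ->
  ((mean f)%:E = volr^-1%:E * \int[leb]_(x in K) (f x)%:E)%E.
Proof.
move=> bf; rewrite EFinM; congr (_ * _)%E; rewrite /Rintegral fineK//.
exact: integrable_fin_num (bmfun_integrable bf).
Qed.

Lemma integral_uniform f : bmfun f -> (forall x, 0 <= f x) ->
  (\int[uniform K]_x (f x)%:E = (mean f)%:E)%E.
Proof.
move=> bf f0; rewrite meanE//.
have v0 : 0 <= volr^-1 by rewrite invr_ge0 ltW ?volr_gt0.
have mf : measurable_fun setT (EFin \o f) by apply/measurable_EFinP; case: bf.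
have UE A : measurable A -> uniform K A = mscale (NngNum v0) (mrestr leb mK) A.
  have ev : mrestr leb mK [set: 'rV[R]_n] = volr%:E by rewrite /mrestr setTI volrE.
  move=> mA; rewrite /uniform /= /mnormalize /= ev eqe (gt_eqF volr_gt0)/=.
  by rewrite /mscale /= muleC.
rewrite (eq_measure_integral (mscale (NngNum v0) (mrestr leb mK))); last first.
  by move=> A mA _; exact: UE.
rewrite ge0_integral_mscale//; last by move=> x _; rewrite lee_fin.
congr (_ * _)%E; rewrite -[setT](setUv S) ge0_integral_setU//; last 4 first.
- exact: measurableC.
- by rewrite setUv.
- by move=> x _; rewrite lee_fin.
- exact/disj_setPCl.
rewrite [X in (_ + X)%E](eq_measure_integral mzero); last first.
  move=> A mA AS; rewrite /= /mrestr (_ : A `&` S = set0) ?measure0//.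
  by apply/seteqP; split=> // x [/AS].
rewrite integral_measure_zero adde0; apply: eq_measure_integral => A mA AS.
by rewrite /= /mrestr (setIidl AS).
Qed.

Lemma bmfun_coord i : bmfun (fun x : 'rV[R]_n => x 0 i).
Proof.
split; first exact: measurable_coord.
have [B _ KB] := convex_body_bounded; exists B => x /KB.
exact: le_trans (coord_le_norm _ _).
Qed.

(** As [integral_uniform] concerns non-negative functions, the coordinate is split into its positive
    and negative parts. *)
Lemma centered_coord i : centered K -> mean (fun x : 'rV[R]_n => x 0 i) = 0.
Proof.
move=> /(_ i); rewrite unlock integralE.
have bi := bmfun_coord i; have bNi := bmfunZ (-1) bi.
have pE : (\int[uniform K]_x ((fun x : 'rV[R]_n => (x 0 i)%:E)^\+ x) =
    (mean (fun x : 'rV[R]_n => Num.max 0 (x 0 i)))%:E)%E.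
  rewrite -integral_uniform; last 2 first.
  - exact: bmfun_max0.
  - by move=> x; rewrite le_max lexx.
  by apply: eq_integral => x _; rewrite funeposE -EFin_max maxC.
have nE : (\int[uniform K]_x ((fun x : 'rV[R]_n => (x 0 i)%:E)^\- x) =
    (mean (fun x : 'rV[R]_n => Num.max 0 (-1 * x 0 i)))%:E)%E.
  rewrite -integral_uniform; last 2 first.
  - exact: bmfun_max0.
  - by move=> x; rewrite le_max lexx.
  by apply: eq_integral => x _; rewrite funenegE -EFinN -EFin_max maxC mulN1r.
rewrite pE nE -EFinD => -[E].
have bN := bmfunZ (-1) (bmfun_max0 bNi).
rewrite (@mean_eq _ (fun x : 'rV[R]_n => Num.max 0 (x 0 i) + -1 * Num.max 0 (-1 * x 0 i))).
  by rewrite meanD ?meanZ//; [rewrite mulN1r|exact: bmfun_max0..].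
by move=> x _; rewrite mulN1r; have [h|h] := leP 0 (x 0 i); have [h'|h'] := leP 0 (-1 * x 0 i); lra.
Qed.

Lemma centered_dot th : centered K -> mean (fun x => dot x th) = 0.
Proof.
move=> cK; rewrite /dot.
suff [] : bmfun (fun x : 'rV[R]_n => \sum_(i <- index_enum 'I_n) x 0 i * th 0 i) /\
    mean (fun x : 'rV[R]_n => \sum_(i <- index_enum 'I_n) x 0 i * th 0 i) = 0 by [].
elim: (index_enum _) => [|i r [IH1 IH2]].
  rewrite (_ : (fun _ => _) = fun=> 0); last by apply/funext => x; rewrite big_nil.
  by split; [exact: bmfun_cst|exact: mean_cst].
rewrite (_ : (fun _ => _) = fun x : 'rV[R]_n => th 0 i * x 0 i + \sum_(i <- r) x 0 i * th 0 i); last first.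
  by apply/funext => x; rewrite big_cons mulrC.
have bi := bmfun_coord i; have bz := bmfunZ (th 0 i) bi.
by split; [exact: bmfunD|rewrite meanD// meanZ// centered_coord// mulr0 IH2 addr0].
Qed.

Lemma marginal_normE r th : 0 < r ->
  marginal_norm K r th = mean (fun x => `|dot x th| `^ r) `^ r^-1.
Proof.
move=> r0; rewrite /marginal_norm unlock.
have b : bmfun (fun x => `|dot x th| `^ r).
  by apply: bmfun_powR => //; [exact: ltW|apply: bmfun_norm; exact: bmfun_dot].
rewrite fine_poweR; congr (_ `^ _).
rewrite -[RHS]/(fine (mean (fun x => `|dot x th| `^ r))%:E) -integral_uniform; last 2 first.
- exact: b.
- by move=> x; exact: powR_ge0.
by congr fine; apply: eq_integral.
Qed.

End mean.

(** * Root concavity of the stop-loss transforms of marginals *)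

Lemma dotZl (R : realType) n (c : R) (x th : 'rV[R]_n) : dot (c *: x) th = c * dot x th.
Proof. by rewrite /dot mulr_sumr; apply: eq_bigr => i _; rewrite mxE mulrA. Qed.

Lemma dotDl (R : realType) n (x y th : 'rV[R]_n) : dot (x + y) th = dot x th + dot y th.
Proof. by rewrite /dot -big_split; apply: eq_bigr => i _; rewrite mxE mulrDl. Qed.

Lemma dotC (R : realType) n (x y : 'rV[R]_n) : dot x y = dot y x.
Proof. by apply: eq_bigr => i _; rewrite mulrC. Qed.

Lemma convex_bodyP (R : realType) n (K : convex_body R n) (x y : 'rV[R]_n) (m : R) :
  0 <= m <= 1 -> convex_body_set K x -> convex_body_set K y ->
  convex_body_set K ((1 - m) *: x + m *: y).
Proof.
move=> /andP[m0 m1] Kx Ky.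
have m'0 : 0 <= 1 - m by lra.
have m'1 : 1 - m <= 1 by lra.
have := @convex_body_convex _ _ K x y (Itv01 m'0 m'1) (mem_set Kx) (mem_set Ky).
by move=> /set_mem; rewrite /conv/= /unstable.onem subKr.
Qed.

Section marginal_stoploss.
Context (R : realType) (n : nat) (K : convex_body R n).
Local Notation S := (convex_body_set K).
Local Notation leb := (lebesgue_rV R n).
Let mK := measurable_convex_body K.

Definition msl (th : 'rV[R]_n) (s : R) : R := mean K (fun x => Num.max 0 (dot x th - s)).

Lemma bmfun_msl th s : bmfun K (fun x => Num.max 0 (dot x th - s)).
Proof. by apply: bmfun_max0; exact: bmfun_dotB. Qed.

(** The positive part of [dot - s], restricted to the body, pulled back by the dilation and divided
    by [c]. The change of variable contributes [c^-n] to the integral and the division one more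
    factor: hence the exponent [n + 1]. *)
Definition dilated (th : 'rV[R]_n) (c s : R) (x : 'rV[R]_n) : R :=
  \1_S (c *: x) * (Num.max 0 (dot (c *: x) th - s) / c).

Lemma measurable_scale_rV (c : R) : measurable_fun setT (fun x : 'rV[R]_n => c *: x).
Proof.
by have := @measurable_affine_rV R n c 0; under eq_fun do rewrite addr0.
Qed.

Lemma measurable_dilated th c s : measurable_fun setT (dilated th c s).
Proof.
have mg : measurable_fun setT (fun x => \1_S x * (Num.max 0 (dot x th - s) / c)).
  apply: measurable_funM; first exact: measurable_indic.
  by apply: measurable_funM => //; case: (bmfun_msl th s).
exact: (measurableT_comp mg (measurable_scale_rV c)).
Qed.

Lemma dilated_ge0 th c s x : 0 < c -> 0 <= dilated th c s x.
Proof.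
by move=> c0; rewrite /dilated mulr_ge0// mulr_ge0 ?invr_ge0 ?le_max ?lexx// ltW.
Qed.

Lemma dilated_bsupp th c s : 0 < c -> exists M, bsupp M (dilated th c s).
Proof.
move=> c0; have [B B0 KB] := convex_body_bounded K.
have [_ [M MK]] := bmfun_msl th s.
exists (Num.max (`|M| / c) (B / c)); split=> x.
  rewrite dilated_ge0//= /dilated indicE le_max; apply/orP; left.
  have [xS|xS] := boolP (c *: x \in S); last by rewrite mul0r divr_ge0// ltW.
  rewrite mul1r ler_pM2r ?invr_gt0//; have := MK _ (set_mem xS).
  move=> h; apply: le_trans (ler_norm _) (le_trans h _); exact: ler_norm.
rewrite gt_max => /andP[_ Bx]; rewrite /dilated indicE memNset ?mul0r//.
move=> /KB; rewrite normrZ gtr0_norm// leNgt mulrC.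
by rewrite ltr_pdivrMr// in Bx; rewrite Bx.
Qed.

Lemma integral_dilated th c s : 0 < c ->
  \int[leb]_x dilated th c s x = (c ^- n.+1) * (volr K * msl th s).
Proof.
move=> c0; rewrite /Rintegral.
pose g (z : 'rV[R]_n) := (\1_S z * (Num.max 0 (dot z th - s) / c))%:E.
have mg : measurable_fun setT g.
  apply/measurable_EFinP; apply: measurable_funM; first exact: measurable_indic.
  by apply: measurable_funM => //; case: (bmfun_msl th s).
have g0 z : (0 <= g z)%E.
  by rewrite lee_fin mulr_ge0// mulr_ge0 ?invr_ge0 ?le_max ?lexx// ltW.
have -> : (\int[leb]_x (dilated th c s x)%:E = \int[leb]_x g (c *: x + 0)%R)%E.
  by apply: eq_integral => x _; rewrite addr0.
rewrite ge0_integral_affine_rV//.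
have -> : (\int[leb]_x g x = (volr K * msl th s / c)%:E)%E.
  rewrite /msl /mean mulVKf ?lt0r_neq0 ?volr_gt0// mulrC -RintegralZl//; last first.
    exact: bmfun_integrable (bmfun_msl th s).
  have bz := bmfunZ c^-1 (bmfun_msl th s).
  rewrite /Rintegral fineK; last exact: integrable_fin_num (bmfun_integrable bz).
  rewrite integral_mkcond; apply: eq_integral => x _.
  rewrite /g patchE indicE; case: ifPn => _; first by rewrite mul1r mulrC.
  by rewrite mul0r.
by rewrite -EFinM/= exprSr invfM; ring.
Qed.

(** The weight [l] makes [w] times the combination of [x] and [y] equal to the combination of [a x]
    and [b y] with weights [1 - m] and [m], which lies in the body by convexity. Moreover
    [(1 - l) / a = (1 - m) / w] and [l / b = m / w], so the arithmetic mean of the two values is the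
    affine expression on the right, and AM-GM concludes. *)
Lemma dilated_PL th a b s0 s1 m w l x y : 0 < m < 1 -> 0 < a -> 0 < b ->
  w = (1 - m) * a + m * b -> l = m * b / w ->
  dilated th a s0 x `^ (1 - l) * dilated th b s1 y `^ l <=
  dilated th w ((1 - m) * s0 + m * s1) ((1 - l) *: x + l *: y).
Proof.
move=> /andP[m0 m1] a0 b0 wE lE.
have m'0 : 0 < 1 - m by lra.
have w0 : 0 < w by rewrite wE addr_gt0 ?mulr_gt0.
have l0 : 0 < l by rewrite lE divr_gt0 ?mulr_gt0.
have wn0 := lt0r_neq0 w0.
have l'E : 1 - l = (1 - m) * a / w.
  by apply: (mulIf wn0); rewrite mulrBl mul1r lE !divfK// wE; ring.
have l'0 : 0 < 1 - l by rewrite l'E divr_gt0 ?mulr_gt0.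
have [xS|xS] := boolP (a *: x \in S); last first.
  by rewrite {1}/dilated indicE (negbTE xS) mul0r powR0 ?lt0r_neq0// mul0r dilated_ge0.
have [yS|yS] := boolP (b *: y \in S); last first.
  by rewrite {2}/dilated indicE (negbTE yS) mul0r (powR0 (lt0r_neq0 l0)) mulr0 dilated_ge0.
have [fx|fx] := leP (dot (a *: x) th - s0) 0.
  by rewrite {1}/dilated (max0_le fx) mul0r mulr0 powR0 ?lt0r_neq0// mul0r dilated_ge0.
have [gy|gy] := leP (dot (b *: y) th - s1) 0.
  by rewrite {2}/dilated (max0_le gy) mul0r mulr0 (powR0 (lt0r_neq0 l0)) mulr0 dilated_ge0.
have wz : w *: ((1 - l) *: x + l *: y) = (1 - m) *: (a *: x) + m *: (b *: y).
  by rewrite scalerDr !scalerA l'E lE; congr (_ *: _ + _ *: _); field.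
have m01 : 0 <= m <= 1 by lra.
have zS : w *: ((1 - l) *: x + l *: y) \in S.
  by rewrite wz; apply/mem_set; apply: convex_bodyP => //; exact: set_mem.
have l01 : 0 < l < 1 by rewrite l0; lra.
apply: le_trans (weighted_AMGM _ _ l01) _; try exact: dilated_ge0.
rewrite /dilated !indicE xS yS zS !mul1r wz dotDl !(dotZl _ (_ *: _)).
set A := dot _ _ in fx *; set B := dot _ _ in gy *.
have -> : Num.max 0 (A - s0) = A - s0 by apply/max_idPr; exact: ltW.
have -> : Num.max 0 (B - s1) = B - s1 by apply/max_idPr; exact: ltW.
apply: (@le_trans _ _ ((((1 - m) * A + m * B) - ((1 - m) * s0 + m * s1)) / w)).
  rewrite le_eqVlt; apply/orP; left; apply/eqP; rewrite l'E lE; field.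
  by rewrite wn0 !lt0r_neq0.
by rewrite ler_pM2r ?invr_gt0// le_max lexx orbT.
Qed.

Lemma logconcave_dilated th c s : 0 < c -> logconcave (dilated th c s).
Proof.
move=> c0 l x y l01.
have E1 : (1 - l) * c + l * c = c by ring.
have E2 : (1 - l) * s + l * s = s by ring.
by rewrite -{3}E2; apply: dilated_PL => //; rewrite ?E1// mulfK// lt0r_neq0.
Qed.

(** The bounds on [a] and [b] say that the two dilated functions have integral at least the volume
    of the body. By Prekopa-Leindler so has the one dilated by [w], which is the claimed bound on
    [w ^+ n.+1]. *)
Lemma root_concave_msl th : root_concave n.+1 (msl th).
Proof.
move=> s0 s1 a b m m01 a0 b0 aU bU.
have [m0|m0] := eqVneq m 0; first by rewrite m0 subr0 !mul1r !mul0r !addr0.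
have [m1|m1] := eqVneq m 1; first by rewrite m1 subrr !mul0r !mul1r !add0r.
have {m01 m0 m1}m01 : 0 < m < 1.
  by case/andP: m01 => h1 h2; rewrite !lt_neqAle h1 h2 eq_sym m0 m1.
have [m0 m1] := andP m01; have m'0 : 0 < 1 - m by lra.
pose w := (1 - m) * a + m * b; pose l := m * b / w.
have w0 : 0 < w by rewrite addr_gt0 ?mulr_gt0.
have l0 : 0 < l by rewrite divr_gt0 ?mulr_gt0.
have l'0 : 0 < 1 - l.
  have -> : 1 - l = (1 - m) * a / w by rewrite /l /w; field; rewrite lt0r_neq0.
  by rewrite divr_gt0 ?mulr_gt0.
have l01 : 0 < l < 1 by rewrite l0; lra.
pose s := (1 - m) * s0 + m * s1.
have [M1 b1] := dilated_bsupp th s0 a0.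
have [M2 b2] := dilated_bsupp th s1 b0.
have [M3 b3] := dilated_bsupp th s w0.
pose M := Num.max M1 (Num.max M2 M3).
have {}b1 : bsupp M (dilated th a s0) by apply: le_bsupp b1; rewrite le_max lexx.
have {}b2 : bsupp M (dilated th b s1) by apply: le_bsupp b2; rewrite !le_max lexx orbT.
have {}b3 : bsupp M (dilated th w s) by apply: le_bsupp b3; rewrite !le_max lexx !orbT.
have := prekopa_leindler l01 (measurable_dilated th a s0) (measurable_dilated th b s1)
  (measurable_dilated th w s) b1 b2 b3 (logconcave_dilated th s0 a0)
  (logconcave_dilated th s1 b0) (fun x y => dilated_PL th s0 s1 x y m01 a0 b0 erefl erefl).
rewrite !integral_dilated//.
have v0 := volr_gt0 K.
have key c r : 0 < c -> c ^+ n.+1 <= msl th r -> volr K <= c ^- n.+1 * (volr K * msl th r).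
  move=> c0 cU; rewrite mulrC ler_pdivlMr ?exprn_gt0//.
  by rewrite ler_pM2l.
have h1 := key _ _ a0 aU; have h2 := key _ _ b0 bU => h3.
have : volr K <= w ^- n.+1 * (volr K * msl th s).
  apply: le_trans h3.
  have {1}-> : volr K = volr K `^ (1 - l) * volr K `^ l.
    rewrite -powRD ?subrK ?powRr1 ?(ltW v0)//.
    by apply/implyP => _; rewrite lt0r_neq0.
  have pos x : volr K <= x -> 0 <= x by move=> h; exact: le_trans (ltW v0) h.
  apply: ler_pM; rewrite ?powR_ge0//; apply: ge0_ler_powR;
    rewrite ?nnegrE ?(ltW l'0) ?(ltW l0) ?(ltW v0)//; exact: pos.
by rewrite mulrC ler_pdivlMr ?exprn_gt0// ler_pM2l.
Qed.

End marginal_stoploss.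

(** * Moments of marginals through their stop-loss transforms *)

Section marginal_moments.
Context (R : realType) (n : nat) (K : convex_body R n).
Local Notation S := (convex_body_set K).
Local Notation leb := (lebesgue_rV R n).
Let mK := measurable_convex_body K.

Lemma dotNr (x th : 'rV[R]_n) : dot x (- th) = - dot x th.
Proof. by rewrite /dot -sumrN; apply: eq_bigr => i _; rewrite mxE mulrN. Qed.

Lemma max0B (y : R) : Num.max 0 (- y) = Num.max 0 y - y.
Proof. by have [h|h] := leP 0 y; have [h'|h'] := leP 0 (- y); lra. Qed.

(** Centering enters here: the positive part of [-Y - s] is that of [Y + s] minus [Y + s], whose
    mean is [s]. *)
Lemma flip_msl th : centered K -> flip (msl K th) = msl K (- th).
Proof.
move=> cK; apply/funext => s; rewrite /flip /msl.
rewrite [RHS](@mean_eq _ _ _ _ (fun x => Num.max 0 (dot x th - - s) + (- s + -1 * dot x th))); last first.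
  move=> x _; rewrite dotNr; have := max0B (dot x th - - s).
  have -> : - (dot x th - - s) = - dot x th - s by ring.
  by move=> ->; ring.
have b1 := bmfun_msl K th (- s); have b2 := bmfunZ (-1) (bmfun_dot K th).
rewrite meanD//; last by apply: bmfunD => //; exact: bmfun_cst.
rewrite meanD//; last exact: bmfun_cst.
by rewrite mean_cst meanZ ?centered_dot ?mulr0 ?addr0//; exact: bmfun_dot.
Qed.

Lemma stoploss_msl th : centered K -> stoploss n (msl K th).
Proof.
move=> cK.
have VE s : msl K th s + s = msl K (- th) (- s).
  by rewrite -flip_msl// /flip !opprK.
have ge0 th' s : 0 <= msl K th' s by apply: mean_ge0 => x _; rewrite le_max lexx.
split.
- exact: ge0.
- by move=> s; rewrite VE.
- move=> t.
  (* Its mean is P(Y > t), and minus this probability is a subgradient of the transform at [t]. *)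
  pose f (x : 'rV[R]_n) : R := if t < dot x th then 1 else 0.
  have bf : bmfun K f.
    split; last by exists 1 => x _; rewrite /f; case: (_ < _); rewrite ?normr1 ?normr0.
    have mlt : measurable_fun setT (fun x : 'rV[R]_n => t < dot x th).
      by apply: measurable_fun_ltr => //; exact: measurable_dot.
    exact: measurable_fun_ifT.
  exists (mean K f).
    apply/andP; split; first by apply: mean_ge0 => x _; rewrite /f; case: ifP.
    rewrite -(mean_cst K 1); apply: mean_le => //; first exact: bmfun_cst.
    by move=> x _; rewrite /f; case: ifP.
  move=> s; have -> : mean K f * (s - t) = mean K (fun x => (s - t) * f x).
    by rewrite meanZ// mulrC.
  rewrite lerBlDr -meanD//; [|exact: bmfun_msl|exact: bmfunZ].
  apply: mean_le; [exact: bmfun_msl|by apply: bmfunD; [exact: bmfun_msl|exact: bmfunZ]|].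
  move=> x _; rewrite /f.
  by case: ltP => h; have [h1|h1] := leP 0 (dot x th - t); have [h2|h2] := leP 0 (dot x th - s); lra.
- exact: root_concave_msl.
- move=> s0 s1 a b m; rewrite !VE opprD -!mulrN => *.
  exact: root_concave_msl.
- have [_ [B hB]] := bmfun_dot K th; exists B => s Bs.
  have kill th' : (forall x, S x -> `|dot x th'| <= B) -> msl K th' s = 0.
    move=> h; rewrite /msl (@mean_eq _ _ _ _ (fun=> 0)) ?mean_cst// => x /h.
    by rewrite ler_norml => /andP[_ h']; apply: max0_le; lra.
  split; first exact: kill.
  have := kill (- th); rewrite -flip_msl// /flip => /(_ _)/eqP; rewrite subr_eq0 => H.
  by apply/eqP/H => x Sx; rewrite dotNr normrN; exact: hB.
Qed.

(** By Tonelli for [pker e k (dot x th) r]: integrating first over the body gives [kfun],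
    integrating first over [r] gives the power of the positive part. *)
Lemma kint_msl th (e k : R) : 0 <= e -> 0 < k ->
  kint e k (msl K th) =
  (pconst e k * mean K (fun x => Num.max 0 (dot x th) `^ (1 + (e + 1) / k)))%:E.
Proof.
move=> e0 k0; set m := 1 + (e + 1) / k.
have m0 : 0 <= m by rewrite addr_ge0// divr_ge0 ?addr_ge0// ltW.
have bm : bmfun K (fun x => Num.max 0 (dot x th) `^ m).
  apply: bmfun_powR => //; last by move=> x; rewrite le_max lexx.
  by apply: bmfun_max0; exact: bmfun_dot.
have v0 : 0 <= (volr K)^-1 by rewrite invr_ge0 ltW ?volr_gt0.
pose F (z : measurableTypeR R * 'rV[R]_n) : \bar R := (\1_S z.2 * pker e k (dot z.2 th) z.1)%:E.
have F0 z : (0 <= F z)%E by rewrite lee_fin mulr_ge0 ?pker_ge0.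
have mF : measurable_fun setT F.
  apply/measurable_EFinP; apply: measurable_funM.
    by apply: (measurableT_comp (measurable_indic mK)); exact: measurable_snd.
  apply: measurable_fun_ifT => //.
  - by apply: measurable_fun_ltr => //; exact: measurable_fst.
  - apply: measurable_funM.
      by apply: (measurableT_comp (measurable_powR _)); exact: measurable_fst.
    apply: measurable_maxr; first exact: measurable_cst.
    apply: measurable_funB.
      by apply: (measurableT_comp (measurable_dot _)); exact: measurable_snd.
    by apply: (measurableT_comp (measurable_powR _)); exact: measurable_fst.
have step1 r : ((kfun e k (msl K th) r)%:E =
    (volr K)^-1%:E * \int[leb]_x F (r, x))%E.
  have bp : bmfun K (fun x => pker e k (dot x th) r).
    rewrite /pker; case: (boolP (0 < r)) => r0; last exact: bmfun_cst.
    by apply: bmfunZ; exact: bmfun_msl.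
  have -> : kfun e k (msl K th) r = mean K (fun x => pker e k (dot x th) r).
    rewrite /kfun /pker; case: (boolP (0 < r)) => r0; last by rewrite mean_cst.
    by rewrite -meanZ//; exact: bmfun_msl.
  rewrite meanE//; congr (_ * _)%E; rewrite integral_mkcond; apply: eq_integral => x _.
  by rewrite /F patchE indicE/=; case: ifPn => _; rewrite ?mul1r ?mul0r.
rewrite /kint; under eq_integral do rewrite step1.
have mG : measurable_fun setT (fun r : measurableTypeR R => \int[leb]_x F (r, x))%E.
  exact: (measurable_fun_fubini_tonelli_F (m2 := @lebesgue_rV_sf R n) F mF F0).
rewrite ge0_integralZl_EFin//; last by move=> r _; exact: integral_ge0.
rewrite (fubini_tonelli (m1 := @lebesgue_measure R) (m2 := @lebesgue_rV_sf R n) F mF F0).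
transitivity ((volr K)^-1%:E * ((pconst e k)%:E *
    \int[leb]_(x in S) (Num.max 0 (dot x th) `^ m)%:E))%E.
  congr (_ * _)%E.
  have mm : measurable_fun S (fun x => (Num.max 0 (dot x th) `^ m)%:E).
    by apply/measurable_EFinP; apply: measurable_funTS; case: bm.
  rewrite -ge0_integralZl_EFin//; [|by move=> x _; rewrite lee_fin powR_ge0
    |by rewrite ltW// pconst_gt0].
  rewrite [RHS]integral_mkcond; apply: eq_integral => x _.
  rewrite patchE /F/= indicE; case: ifPn => xS; last first.
    by apply: integral0_eq => r _; rewrite mul0r.
  under eq_integral do rewrite mul1r.
  by rewrite integral_pker// EFinM.
by rewrite muleCA -(meanE bm) -EFinM.
Qed.

(** The negative part needs no separate notion: its moment is that of [- th]. *)
Definition mom (p : R) (th : 'rV[R]_n) : R := mean K (fun x => Num.max 0 (dot x th) `^ p).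

Lemma bmfun_mom p th : 0 <= p -> bmfun K (fun x => Num.max 0 (dot x th) `^ p).
Proof.
move=> p0; apply: bmfun_powR => //; last by move=> x; rewrite le_max lexx.
by apply: bmfun_max0; exact: bmfun_dot.
Qed.

Lemma mom_ge0 p th : 0 <= mom p th.
Proof. by apply: mean_ge0 => x _; exact: powR_ge0. Qed.

Lemma momZ p c th : 0 <= p -> 0 <= c -> mom p (c *: th) = c `^ p * mom p th.
Proof.
move=> p0 c0; rewrite /mom -meanZ; last exact: bmfun_mom.
apply: mean_eq => x _; have -> : dot x (c *: th) = c * dot x th.
  by rewrite dotC dotZl dotC.
by rewrite -powRM ?le_max ?lexx// maxr_pMr// mulr0.
Qed.

Lemma mean_norm_mom p th : 0 < p ->
  mean K (fun x => `|dot x th| `^ p) = mom p th + mom p (- th).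
Proof.
move=> p0; rewrite -meanD; try exact/bmfun_mom/ltW.
apply: mean_eq => x _; rewrite dotNr.
have [h|h] := leP 0 (dot x th).
  by rewrite ger0_norm// (max0_le (_ : - _ <= 0)) ?oppr_le0// powR0 ?lt0r_neq0// addr0.
by rewrite ltr0_norm// powR0 ?lt0r_neq0// add0r (max_idPr (_ : 0 <= _)) ?oppr_ge0 ?ltW.
Qed.

End marginal_moments.

(** * Continuity and positivity of the moments *)

(** AM-GM with weights [1 - 1/p] and [1/p] gives [p * b^(p-1) * a <= (p-1) * b^p + a^p], the tangent
    inequality of the power at the larger point [b]. *)
Lemma powR_lipschitz (R : realType) (p M a b : R) : 1 <= p ->
  0 <= a <= M -> 0 <= b <= M -> `|a `^ p - b `^ p| <= p * M `^ (p - 1) * `|a - b|.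
Proof.
move=> p1; wlog ab : a b / a <= b.
  move=> h ha hb; have [ab|ba] := leP a b; first exact: h.
  by rewrite distrC (distrC a); apply: h => //; exact: ltW.
move=> /andP[a0 aM] /andP[b0 bM].
have p0 : 0 < p by lra.
have powle : a `^ p <= b `^ p by apply: ge0_ler_powR; rewrite ?nnegrE// ltW.
rewrite distrC (distrC a) !ger0_norm ?subr_ge0//.
have [p1'|p1'] := eqVneq p 1.
  by rewrite p1' subrr powRr0 !powRr1// mulr1 mul1r.
have {p1'}p1 : 1 < p by rewrite lt_neqAle eq_sym p1'.
have [b00|b00] := eqVneq b 0.
  have a00 : a = 0 by lra.
  by rewrite b00 a00 !subrr mulr0.
have {b00}b0' : 0 < b by rewrite lt_neqAle eq_sym b00.
have pi01 : 0 < p^-1 < 1 by rewrite invr_gt0 p0 invf_lt1.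
have := weighted_AMGM (powR_ge0 b p) (powR_ge0 a p) pi01.
rewrite -!powRrM mulfV ?lt0r_neq0// (powRr1 a0).
have -> : p * (1 - p^-1) = p - 1 by rewrite mulrBr mulr1 mulfV// lt0r_neq0.
move=> h.
have h2 : p * (b `^ (p - 1) * a) <= (p - 1) * b `^ p + a `^ p.
  have := ler_wpM2l (ltW p0) h; rewrite mulrDr !mulrA mulfV ?lt0r_neq0// mul1r.
  by have -> : p * (1 - p^-1) = p - 1 by rewrite mulrBr mulr1 mulfV// lt0r_neq0.
apply: (@le_trans _ _ (p * b `^ (p - 1) * (b - a))).
  have E := mulr_powRB1 b0 p0; rewrite mulrBr -[p * _ * b]mulrA (mulrC _ b) E.
  rewrite -[p * _ * a]mulrA; lra.
apply: ler_wpM2r; first by rewrite subr_ge0.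
apply: ler_wpM2l; first exact: ltW.
by apply: ge0_ler_powR; rewrite ?nnegrE//; lra.
Qed.

Section mom_regularity.
Context (R : realType) (n : nat) (K : convex_body R n).
Local Notation S := (convex_body_set K).

Lemma dot_norm_le (x u : 'rV[R]_n) : `|dot x u| <= n%:R * (`|x| * `|u|).
Proof.
apply: le_trans (ler_norm_sum _ _ _) _.
apply: (@le_trans _ _ (\sum_(i < n) `|x| * `|u|)).
  by apply: ler_sum => i _; rewrite normrM ler_pM// coord_le_norm.
by rewrite sumr_const card_ord mulr_natl.
Qed.

Lemma mean_dist f g e : bmfun K f -> bmfun K g -> (forall x, S x -> `|f x - g x| <= e) ->
  `|mean K f - mean K g| <= e.
Proof.
move=> bf bg fg.
have le u v : bmfun K u -> bmfun K v -> (forall x, S x -> u x <= v x + e) -> mean K u <= mean K v + e.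
  move=> bu bv uv; rewrite -[in leRHS](mean_cst K e) -meanD//; last exact: bmfun_cst.
  by apply: mean_le => //; apply: bmfunD => //; exact: bmfun_cst.
have h1 : mean K f <= mean K g + e.
  by apply: le => // x /fg; rewrite ler_norml => /andP[]; lra.
have h2 : mean K g <= mean K f + e.
  by apply: le => // x /fg; rewrite ler_norml => /andP[]; lra.
by rewrite ler_norml; apply/andP; split; lra.
Qed.

Lemma max0_lip (a b : R) : `|Num.max 0 a - Num.max 0 b| <= `|a - b|.
Proof.
have h1 := ler_norm (a - b); have h2 := ler_norm (b - a).
rewrite distrC in h2; rewrite ler_norml.
by have [ha|ha] := leP 0 a; have [hb|hb] := leP 0 b; apply/andP; split; lra.
Qed.

Lemma mom_continuous p : 1 <= p -> continuous (mom K p).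
Proof.
move=> p1 th; have [B B0 KB] := convex_body_bounded K.
pose D := n%:R * B; pose M := D * (`|th| + 1).
have D0 : 0 <= D by rewrite mulr_ge0// ltW.
have dD x u : S x -> `|dot x u| <= D * `|u|.
  move=> /KB xB; apply: le_trans (dot_norm_le _ _) _.
  by rewrite /D -mulrA ler_wpM2l// ler_wpM2r.
pose C := p * M `^ (p - 1) * D + 1.
have C0' : 0 <= p * M `^ (p - 1) by rewrite mulr_ge0 ?powR_ge0//; lra.
have C0 : 0 < C by have := mulr_ge0 C0' D0; rewrite /C; lra.
apply: (iffRL (@cvgrPdist_lt _ _ _ (nbhs th) _ (mom K p) (mom K p th))) => e e0.
apply/nbhs_ballP.
exists (Num.min 1 (e / C)); first by rewrite /= lt_min ltr01 divr_gt0.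
move=> u; rewrite -ball_normE/= lt_min => /andP[u1 ue].
have p0 : 0 <= p by lra.
have uth : `|u| <= `|th| + 1.
  rewrite -[u](subrK th); apply: le_trans (ler_normD _ _) _.
  by rewrite distrC addrC lerD2l ltW.
apply: (@le_lt_trans _ _ (p * M `^ (p - 1) * (D * `|th - u|))).
  apply: mean_dist; [exact: bmfun_mom|exact: bmfun_mom|].
  move=> x Sx.
  have inM v : `|v| <= `|th| + 1 -> 0 <= Num.max 0 (dot x v) <= M.
    move=> vle; rewrite le_max lexx/= ge_max mulr_ge0 ?addr_ge0//=.
    apply: le_trans (ler_norm _) (le_trans (dD _ _ Sx) _).
    by rewrite ler_wpM2l.
  apply: le_trans (powR_lipschitz p1 (inM th _) (inM u uth)) _; first by rewrite lerDl.
  apply: ler_wpM2l => //; apply: le_trans (max0_lip _ _) _.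
  have -> : dot x th - dot x u = dot x (th - u).
    by rewrite -dotNr dotC (dotC x (- u)) -dotDl dotC.
  exact: dD.
apply: (@le_lt_trans _ _ (C * `|th - u|)).
  by rewrite mulrA ler_wpM2r// /C lerDl.
by rewrite mulrC -ltr_pdivlMr.
Qed.

Lemma mean_norm_gt0 p th : 0 < p -> th != 0 -> 0 < mean K (fun x => `|dot x th| `^ p).
Proof.
move=> p0 th0; have [x0 [r [r0 rK]]] := convex_body_ball K.
have tt : 0 < dot th th.
  have [i thi] : exists i, th 0 i != 0.
    apply/existsP; apply: contraNT th0; rewrite negb_exists => /forallP h.
    by apply/eqP/rowP => i; rewrite mxE; apply/eqP; have := h i; rewrite negbK.
  rewrite /dot (bigD1 i)//= ltr_wpDr ?sumr_ge0//.
    by move=> j _; rewrite -expr2 sqr_ge0.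
  by rewrite -expr2 exprn_even_gt0.
have nth : 0 < `|th| by rewrite normr_gt0.
(* If the functional vanishes at the centre of the ball, the centre is moved along [th] by half the
   radius and the radius is halved. *)
have [x1 [r1 [r10 rK1 dx1]]] : exists x1 r1, [/\ 0 < r1, ball x1 r1 `<=` S & dot x1 th != 0].
  have [d0|d0] := eqVneq (dot x0 th) 0; last by exists x0, r.
  exists (x0 + (r / 2 / `|th|) *: th), (r / 2); split.
  - by rewrite divr_gt0.
  - move=> y; rewrite -ball_normE/= => yb; apply: rK; rewrite -ball_normE/=.
    have -> : x0 - y = (x0 + (r / 2 / `|th|) *: th - y) - (r / 2 / `|th|) *: th.
      by rewrite addrAC addrK.
    apply: le_lt_trans (ler_normB _ _) _.
    rewrite normrZ ger0_norm ?divfK ?lt0r_neq0//; last by rewrite ltW// !divr_gt0.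
    by rewrite [ltRHS]splitr ltrD2r.
  - by rewrite dotDl d0 add0r dotZl mulf_neq0// lt0r_neq0// !divr_gt0.
pose c := `|dot x1 th| / 2.
have c0 : 0 < c by rewrite divr_gt0// normr_gt0.
(* On this ball [dot] stays at least half as large as at [x1], in absolute value. *)
pose rr := Num.min r1 (c / (n%:R * `|th| + 1)).
have nn1 : 0 < n%:R * `|th| + 1 by rewrite ltr_wpDl// mulr_ge0.
have rr0 : 0 < rr by rewrite lt_min r10 divr_gt0.
have bS : ball x1 rr `<=` S.
  by apply: subset_trans rK1; apply: le_ball; rewrite ge_min lexx.
have mb : measurable (ball x1 rr) by exact: measurable_ball_rV.
have bi : bmfun K (\1_(ball x1 rr)).
  split; first exact: measurable_indic.
  by exists 1 => x _; rewrite indicE; case: (_ \in _); rewrite ?normr1 ?normr0.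
apply: (@lt_le_trans _ _ (mean K (fun x => c `^ p * \1_(ball x1 rr) x))); last first.
  apply: mean_le; [exact: bmfunZ| |].
    by apply: bmfun_powR; [exact: ltW|by apply: bmfun_norm; exact: bmfun_dot|].
  move=> x Sx; rewrite indicE; case: (boolP (x \in _)) => xb; last first.
    by rewrite mulr0 powR_ge0.
  rewrite mulr1; apply: ge0_ler_powR; rewrite ?nnegrE ?(ltW p0) ?(ltW c0)//.
  have := set_mem xb; rewrite -ball_normE/= lt_min => /andP[_].
  rewrite ltr_pdivlMr// => h.
  have dE : dot x1 th = dot x th + dot (x1 - x) th by rewrite -dotDl addrC subrK.
  have d1 := dot_norm_le (x1 - x) th.
  have d2 : `|dot x1 th| <= `|dot x th| + `|dot (x1 - x) th| by rewrite dE ler_normD.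
  have cE : `|dot x1 th| = c + c by rewrite /c; field.
  by have := normr_ge0 (x1 - x); rewrite mulrDr mulr1 mulrCA mulrC in h; lra.
rewrite (meanZ (c `^ p) bi) mulr_gt0 ?powR_gt0// /mean mulr_gt0 ?invr_gt0 ?volr_gt0//.
rewrite /Rintegral integral_indic//; last exact: measurable_convex_body.
by rewrite (setIidl bS) lebesgue_rV_ball//= exprn_gt0// mulrn_wgt0.
Qed.

End mom_regularity.

(** * Existence of the maximum over the sphere *)

Section alpha_max.
Context (R : realType) (n : nat) (K : convex_body R n).
Local Notation S := (convex_body_set K).

Definition amom (r : R) (th : 'rV[R]_n) : R := mom K r th + mom K r (- th).

Lemma amomE r th : 0 < r -> amom r th = mean K (fun x => `|dot x th| `^ r).
Proof. by move=> r0; rewrite mean_norm_mom. Qed.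

Lemma amom_gt0 r th : 0 < r -> th != 0 -> 0 < amom r th.
Proof. by move=> r0 th0; rewrite amomE// mean_norm_gt0. Qed.

Lemma marginal_norm_amom r th : 0 < r -> marginal_norm K r th = amom r th `^ r^-1.
Proof. by move=> r0; rewrite marginal_normE// amomE. Qed.

Lemma amom_continuous r : 1 <= r -> continuous (amom r).
Proof.
move=> r1 th.
have h : mom K r (- u) @[u --> th] --> mom K r (- th).
  apply: (@continuous_comp _ _ _ (fun u : 'rV[R]_n => - u) (mom K r)).
    exact: opp_continuous.
  exact: (mom_continuous r1).
exact: (cvgD (mom_continuous r1 (x := th)) h).
Qed.

Lemma dot_continuous : continuous (fun th : 'rV[R]_n => dot th th).
Proof.
rewrite /dot; elim: (index_enum _) => [|i s IH].
  rewrite (_ : (fun _ => _) = cst 0); first exact: cst_continuous.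
  by apply/funext => x; rewrite big_nil.
rewrite (_ : (fun _ => _) = fun th : 'rV[R]_n =>
    th 0 i * th 0 i + \sum_(j <- s) th 0 j * th 0 j); last first.
  by apply/funext => x; rewrite big_cons.
move=> x; have ci := @coord_continuous R 1 n 0 i x.
exact: (cvgD (cvgM ci ci) (IH x)).
Qed.

Lemma unit_sphere_neq0 th : @unit_sphere R n th -> th != 0.
Proof.
rewrite /unit_sphere/= => h; apply/eqP => th0; move: h.
rewrite th0 /dot big1 ?sqrtr0; first by move/eqP; rewrite eq_sym oner_eq0.
by move=> i _; rewrite mxE mul0r.
Qed.

Lemma compact_unit_sphere : compact (@unit_sphere R n).
Proof.
have sE : @unit_sphere R n = (fun th => dot th th) @^-1` [set 1].
  apply/seteqP; split=> th; rewrite /unit_sphere/=; last by move=> ->; rewrite sqrtr1.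
  by move=> h; rewrite -[LHS]sqr_sqrtr ?h ?expr1n// sumr_ge0// => i _; rewrite -expr2 sqr_ge0.
apply: bounded_closed_compact; last first.
  rewrite sE; apply: closed_comp; last exact: closed_eq.
  by move=> x _; exact: dot_continuous.
exists 1; split; first exact: num_real.
move=> M M1 th; rewrite sE/= => th1; apply: norm_le_coord => [|i]; first lra.
apply: le_trans (ltW M1); rewrite -(@expr_le1 _ 2)// -th1 /dot (bigD1 i)//=.
rewrite -normrX ger0_norm ?sqr_ge0// expr2 lerDl sumr_ge0// => j _.
by rewrite -expr2 sqr_ge0.
Qed.

Lemma amom_powR r th : 0 < r -> th != 0 -> amom r th `^ r^-1 = expR (ln (amom r th) / r).
Proof. by move=> r0 th0; rewrite /powR gt_eqF ?amom_gt0// mulrC. Qed.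

Definition mratio (p q : R) (th : 'rV[R]_n) : R :=
  marginal_norm K q th / marginal_norm K p th.

Lemma mratioE p q th : 0 < p -> 0 < q -> th != 0 ->
  mratio p q th = expR (ln (amom q th) / q - ln (amom p th) / p).
Proof.
by move=> p0 q0 th0; rewrite /mratio !marginal_norm_amom// !amom_powR// expRB.
Qed.

(** This rules out the default value of [xget]: the sphere is compact, and non-empty as [0 < n], and
    the logarithm of the ratio is continuous off the origin, where the moments are positive. *)
Lemma alpha_is_maximum p q : (0 < n)%N -> 1 <= p -> 1 <= q ->
  is_maximum [set mratio p q theta | theta in @unit_sphere R n] (alpha p q K).
Proof.
move=> n0 p1 q1.
have p0 : 0 < p by lra.
have q0 : 0 < q by lra.
have S0 : @unit_sphere R n !=set0.
  exists (delta_mx 0 (Ordinal n0)); rewrite /unit_sphere/= /dot (bigD1 (Ordinal n0))//=.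
  rewrite big1 ?mxE ?eqxx ?mulr1 ?addr0 ?sqrtr1// => i /negbTE iN.
  by rewrite mxE iN mul0r.
pose g r : 'rV[R]_n -> R := (@ln R \o amom r) \* cst r^-1.
pose f th := g q th - g p th.
have cf : {within @unit_sphere R n, continuous f}.
  apply: continuous_in_subspaceT => th /set_mem/unit_sphere_neq0 th0.
  have cl r : 1 <= r -> 0 < r -> {for th, continuous (g r)}.
    move=> r1 r0.
    have c1 : {for th, continuous (@ln R \o amom r)}.
      apply: (@continuous_comp _ _ _ (amom r) (@ln R)); first exact: amom_continuous.
      by apply: continuous_ln; exact: amom_gt0.
    have c2 : {for th, continuous (cst r^-1 : 'rV[R]_n -> R)} by exact: cst_continuous.
    exact: (@continuousM _ _ (@ln R \o amom r) (cst r^-1) th c1 c2).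
  have -> : f = g q - g p by apply/funext.
  have := @continuousB R R^o _ (g q) (g p) th.
  by apply; exact: cl.
have [th /set_mem Sth fmax] := EVT_max_rV S0 compact_unit_sphere cf.
rewrite /alpha; apply: (@xgetPex _ 0 (is_maximum _)).
exists (mratio p q th); split; first by exists th.
move=> _ [u Su <-].
rewrite (mratioE p0 q0 (unit_sphere_neq0 Su)) (mratioE p0 q0 (unit_sphere_neq0 Sth)).
rewrite ler_expR; exact: (fmax u (mem_set Su)).
Qed.

(** The ratio is invariant under scaling, so the directions found on the simplex can be used without
    normalisation. *)
Lemma mratio_le_alpha p q th : (0 < n)%N -> 1 <= p -> 1 <= q ->
  th != 0 -> mratio p q th <= alpha p q K.
Proof.
move=> n0 p1 q1 th0; have [_ ub] := alpha_is_maximum n0 p1 q1.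
have p0 : 0 < p by lra.
have q0 : 0 < q by lra.
have tt : 0 < dot th th.
  have [i thi] : exists i, th 0 i != 0.
    apply/existsP; apply: contraNT th0; rewrite negb_exists => /forallP h.
    by apply/eqP/rowP => i; rewrite mxE; apply/eqP; have := h i; rewrite negbK.
  rewrite /dot (bigD1 i)//= ltr_wpDr ?sumr_ge0//.
    by move=> j _; rewrite -expr2 sqr_ge0.
  by rewrite -expr2 exprn_even_gt0.
pose c := (Num.sqrt (dot th th))^-1.
have c0 : 0 < c by rewrite invr_gt0 sqrtr_gt0.
have cth : @unit_sphere R n (c *: th).
  rewrite /unit_sphere/= dotZl dotC dotZl mulrA -expr2 /c exprVn sqr_sqrtr ?(ltW tt)//.
  by rewrite mulVf ?sqrtr1// lt0r_neq0.
have scale r : 0 < r -> marginal_norm K r (c *: th) = c * marginal_norm K r th.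
  move=> r0; rewrite !marginal_norm_amom// /amom -scalerN !momZ ?(ltW r0) ?(ltW c0)//.
  rewrite -mulrDr powRM ?powR_ge0 ?addr_ge0 ?mom_ge0//.
  by rewrite -powRrM mulfV ?lt0r_neq0// powRr1// ltW.
have := ub _ (imageP _ cth).
rewrite {1}/mratio (scale _ q0) (scale _ p0) -mulf_div mulfV ?mul1r//.
exact: lt0r_neq0.
Qed.

End alpha_max.

(** * Barycentric coordinates *)

Section barycentric.
Context (R : realType) (n : nat) (v : 'I_n.+1 -> 'rV[R]_n).
Hypothesis av : affinely_independent v.

(** The rows are the vertices in homogeneous coordinates. Affine independence makes the matrix
    invertible, and the inverse contains the barycentric coordinates as affine functions. *)
Definition vertex_mx : 'M[R]_n.+1 := \matrix_(j, k) rV_cons (v j, 1) 0 k.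

Lemma vertex_mx_unit : vertex_mx \in unitmx.
Proof.
rewrite -row_free_unit; apply/row_freeP => /=.
have : kermx vertex_mx = 0.
  apply/row_matrixP => i; rewrite row0.
  set w := row i _; have wA : w *m vertex_mx = 0.
    by rewrite /w -row_mul mulmx_ker row0.
  have w0 j : w 0 j = 0.
    apply: (av (c := fun j => w 0 j)).
      have := congr1 (fun M : 'rV[R]_n.+1 => M 0 0) wA.
      rewrite mxE [RHS]mxE => h; apply: etrans h; apply: eq_bigr => k _.
      by rewrite [X in _ = _ * X]mxE rV_cons0 mulr1.
    apply/rowP => k; have := congr1 (fun M : 'rV[R]_n.+1 => M 0 (lift ord0 k)) wA.
    rewrite mxE [RHS]mxE => h; rewrite summxE [RHS]mxE; apply: etrans h; apply: eq_bigr => l _.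
    by rewrite [LHS]mxE [X in _ = _ * X]mxE rV_consS.
  by apply/rowP => j; rewrite w0 [RHS]mxE.
move/eqP; rewrite kermx_eq0 => /row_freeP[B hB]; by exists B.
Qed.

(** The gradient of a barycentric coordinate, hence a normal of the facet opposite [v i]. *)
Definition bary_dir (i : 'I_n.+1) : 'rV[R]_n := \row_k invmx vertex_mx (lift ord0 k) i.

Definition bary (i : 'I_n.+1) (x : 'rV[R]_n) : R :=
  dot x (bary_dir i) + invmx vertex_mx 0 i.

Lemma baryE i x : bary i x = (rV_cons (x, 1) *m invmx vertex_mx) 0 i.
Proof.
rewrite mxE big_ord_recl rV_cons0 mul1r addrC; congr (_ + _).
by apply: eq_bigr => k _; rewrite rV_consS mxE.
Qed.

Lemma bary_vertex i j : bary i (v j) = (i == j)%:R.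
Proof.
rewrite baryE.
have -> : rV_cons (v j, 1) = row j vertex_mx by apply/rowP => k; rewrite !mxE.
by rewrite -row_mul mulmxV ?vertex_mx_unit// rowE mulmx1 mxE eqxx eq_sym.
Qed.

Lemma bary_inv x : (\row_i bary i x) *m vertex_mx = rV_cons (x, 1).
Proof.
rewrite (_ : \row_i _ = rV_cons (x, 1) *m invmx vertex_mx).
  by rewrite mulmxKV// vertex_mx_unit.
by apply/rowP => i; rewrite mxE baryE.
Qed.

Lemma sum_bary x : \sum_i bary i x = 1.
Proof.
have := congr1 (fun M : 'rV[R]_n.+1 => M 0 0) (bary_inv x).
rewrite rV_cons0 mxE => <-; apply: eq_bigr => i _.
by rewrite mxE [X in _ = _ * X]mxE rV_cons0 mulr1.
Qed.

Lemma bary_combination x : \sum_i bary i x *: v i = x.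
Proof.
apply/rowP => k; have := congr1 (fun M : 'rV[R]_n.+1 => M 0 (lift ord0 k)) (bary_inv x).
rewrite rV_consS mxE => <-; rewrite summxE; apply: eq_bigr => i _.
by rewrite [LHS]mxE mxE [X in _ = _ * X]mxE rV_consS.
Qed.

Lemma bary_affine i (m : R) x y :
  bary i ((1 - m) *: x + m *: y) = (1 - m) * bary i x + m * bary i y.
Proof. by rewrite /bary dotDl !dotZl; ring. Qed.

Lemma bary_sum i (c : 'I_n.+1 -> R) : \sum_j c j = 1 ->
  bary i (\sum_j c j *: v j) = c i.
Proof.
move=> c1; have : bary i (\sum_j c j *: v j) = \sum_j c j * bary i (v j).
  have dotsum : dot (\sum_j c j *: v j) (bary_dir i) = \sum_j c j * dot (v j) (bary_dir i).
    apply: (big_ind2 (fun x y => dot x (bary_dir i) = y)).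
    - by rewrite /dot big1// => k _; rewrite mxE mul0r.
    - by move=> x1 x2 y1 y2 <- <-; rewrite dotDl.
    - by move=> j _; rewrite dotZl.
  rewrite /bary dotsum; under [RHS]eq_bigr do rewrite mulrDr.
  by rewrite big_split/= -mulr_suml c1 mul1r.
move=> ->; rewrite (bigD1 i)//= bary_vertex eqxx mulr1 big1 ?addr0// => j ji.
by rewrite bary_vertex eq_sym (negbTE ji) mulr0.
Qed.

Lemma convex_hullP x : convex_hull v x <-> forall i, 0 <= bary i x.
Proof.
split=> [[c [c0 c1] <-] i|h]; first by rewrite bary_sum.
exists (fun i => bary i x); last exact: bary_combination.
by split=> //; exact: sum_bary.
Qed.

End barycentric.

(** * Conic marginals of a simplex *)

Section simplex_conic.
Context (R : realType) (n : nat) (K : convex_body R n) (v : 'I_n.+1 -> 'rV[R]_n).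
Hypotheses (av : affinely_independent v) (Kv : convex_body_set K = convex_hull v).
Local Notation S := (convex_body_set K).
Local Notation leb := (lebesgue_rV R n).

(* The functional x |-> g * bary i1 x - b * bary i0 x without its constant term:
   it vanishes at all vertices but [v i0] and [v i1]. *)
Definition simplex_dir (i0 i1 : 'I_n.+1) (b g : R) : 'rV[R]_n :=
  g *: bary_dir v i1 - b *: bary_dir v i0.

(** The common value of [simplex_dir] at the vertices other than [v i0] and [v i1], where both
    coordinates vanish. *)
Definition simplex_knot (i0 i1 : 'I_n.+1) (b g : R) : R :=
  b * invmx (vertex_mx v) 0 i0 - g * invmx (vertex_mx v) 0 i1.

Lemma simplex_dirE i0 i1 b g x :
  dot x (simplex_dir i0 i1 b g) - simplex_knot i0 i1 b g = g * bary v i1 x - b * bary v i0 x.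
Proof.
rewrite /simplex_dir /simplex_knot /bary dotC dotDl -scaleNr !dotZl !(dotC _ x); ring.
Qed.

Lemma simplex_dirN i0 i1 b g : - simplex_dir i0 i1 b g = simplex_dir i1 i0 g b.
Proof. by rewrite /simplex_dir opprB. Qed.

Lemma simplex_knotN i0 i1 b g : - simplex_knot i0 i1 b g = simplex_knot i1 i0 g b.
Proof. by rewrite /simplex_knot opprB. Qed.

Lemma integral_msl th s :
  (\int[leb]_x (\1_S x * Num.max 0 (dot x th - s))%:E = (volr K * msl K th s)%:E)%E.
Proof.
rewrite EFinM /msl (meanE (bmfun_msl K th s)) muleA -EFinM mulfV ?lt0r_neq0 ?volr_gt0//.
rewrite mul1e [RHS]integral_mkcond; apply: eq_integral => x _; rewrite patchE indicE.
by case: ifPn => _; rewrite ?mul1r ?mul0r.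
Qed.

(* The part of the simplex beyond level [s] is the homothetic image, with centre
   the vertex [v i1], of the part beyond the knot. *)
Lemma simplex_homothety i0 i1 b g r : i0 != i1 -> 0 <= b -> 0 < g -> 0 <= r < g ->
  let th := simplex_dir i0 i1 b g in let t := simplex_knot i0 i1 b g in
  msl K th (t + r) = (1 - r / g) ^+ n.+1 * msl K th t.
Proof.
(* [g] is the height of [v i1] above the knot, so [m] is the ratio of the homothety that moves level
   [t] to level [t + r]. *)
move=> i01 b0 g0 /andP[r0 rg] th t; set m := 1 - r / g.
have m0 : 0 < m by rewrite subr_gt0 ltr_pdivrMr// mul1r.
have m1 : 0 <= 1 - m by rewrite /m subKr divr_ge0// ltW.
pose F s (z : 'rV[R]_n) := (\1_S z * Num.max 0 (dot z th - s))%:E.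
have F0 s z : (0 <= F s z)%E by rewrite lee_fin mulr_ge0// le_max lexx.
have mF s : measurable_fun setT (F s).
  apply/measurable_EFinP; apply: measurable_funM.
    by apply: measurable_indic; exact: measurable_convex_body.
  by case: (bmfun_msl K th s).
have := ge0_integral_affine_rV ((1 - m) *: v i1) m0 (mF (t + r)) (F0 (t + r)).
have -> : (\int[leb]_x F (t + r)%R (m *: x + (1 - m) *: v i1)%R =
    m%:E * \int[leb]_x F t x)%E.
  rewrite -ge0_integralZl_EFin//; last exact: ltW.
  apply: eq_integral => x _; rewrite -EFinM; congr EFin.
  rewrite addrC; set z := _ + _.
  have zE i : bary v i z = (1 - m) * (i == i1)%:R + m * bary v i x.
    by rewrite bary_affine bary_vertex.
  have e1 : dot z th - (t + r) = m * (dot x th - t).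
    rewrite opprD addrA !simplex_dirE !zE eqxx (negbTE i01) mulr1 mulr0 add0r.
    have -> : r = g * (1 - m) by rewrite /m subKr mulrC divfK// lt0r_neq0.
    by ring.
  rewrite e1; have -> : Num.max 0 (m * (dot x th - t)) = m * Num.max 0 (dot x th - t).
    by rewrite maxr_pMr ?mulr0// ltW.
  have [h|h] := leP (dot x th - t) 0; first by rewrite !mulr0.
  rewrite mulrCA; congr (_ * (_ * _)); rewrite !indicE; congr ((nat_of_bool _)%:R).
  have hx : 0 < g * bary v i1 x - b * bary v i0 x by rewrite -simplex_dirE.
  (* The homothety multiplies every coordinate but [i1] by [m]. The coordinate [i1] of [x] is
     non-negative because [x] lies beyond the knot: [g * bary v i1 x] exceeds [b * bary v i0 x]. *)
  apply/idP/idP => /set_mem; rewrite Kv => /(convex_hullP av) pos; apply/mem_set;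
    apply/(convex_hullP av) => i.
    have [->|ii1] := eqVneq i i1.
      have b00 : 0 <= bary v i0 x.
        by have := pos i0; rewrite zE (negbTE i01) mulr0 add0r pmulr_rge0.
      have := mulr_ge0 b0 b00 => h2.
      by rewrite -(pmulr_rge0 _ g0); lra.
    by have := pos i; rewrite zE (negbTE ii1) mulr0 add0r pmulr_rge0.
  by rewrite zE addr_ge0 ?mulr_ge0// ltW.
rewrite !integral_msl -!EFinM => -[E].
have v0 := lt0r_neq0 (volr_gt0 K); have mn0 := lt0r_neq0 m0.
have -> : msl K th (t + r) = (volr K)^-1 * (m ^+ n * (m * (volr K * msl K th t))).
  by rewrite E mulVKf ?expf_neq0// mulKf.
by rewrite exprS; field.
Qed.

(** The root of the transform falls linearly from its value at the knot to 0 at height [g], the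
    image of [v i1]; hence the slope [x / g]. The clause for [g = 0] supplies, after exchanging the
    vertices, the one-sided cones of [kint_extreme]. *)
Lemma simplex_right i0 i1 b g : i0 != i1 -> 0 <= b -> 0 <= g ->
  let th := simplex_dir i0 i1 b g in let t := simplex_knot i0 i1 b g in
  exists x k, [/\ 0 <= x, 0 <= k, g = 0 -> x = 0 /\ k = 0 &
    forall s, t <= s -> msl K th s = Num.max 0 (x - k * (s - t)) ^+ n.+1].
Proof.
move=> i01 b0 g0 th t.
have msl0 s : t <= s -> g <= s - t -> msl K th s = 0.
  move=> ts gs; rewrite /msl (@mean_eq _ _ _ _ (fun=> 0)) ?mean_cst// => x Sx.
  have pos : forall i, 0 <= bary v i x by apply/(convex_hullP av); rewrite -Kv.
  apply: max0_le; have := simplex_dirE i0 i1 b g x; rewrite -/th -/t => xE.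
  have le1 : bary v i1 x <= 1.
    by rewrite -(sum_bary av x) (bigD1 i1)//= lerDl sumr_ge0.
  have h1 := mulr_ge0 b0 (pos i0).
  have h2 : g * bary v i1 x <= g by rewrite -[leRHS]mulr1 ler_wpM2l.
  lra.
have [g00|gn0] := eqVneq g 0.
  exists 0, 0; split=> // s ts; rewrite mul0r subr0 maxxx expr0n/=.
  by apply: msl0 => //; rewrite g00 subr_ge0.
have {gn0}gp : 0 < g by rewrite lt_neqAle eq_sym gn0.
have U0 : 0 <= msl K th t by apply: mean_ge0 => x _; rewrite le_max lexx.
have [x x0 xE] := nth_root n U0.
exists x, (x / g); split=> //; first by rewrite divr_ge0.
  by move=> g00; rewrite g00 ltxx in gp.
move=> s ts; have [gs|sg] := leP g (s - t).
  rewrite msl0// max0_le ?expr0n// subr_le0 -mulrA ler_peMr//.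
  by rewrite mulrC ler_pdivlMr// mul1r.
have -> : s = t + (s - t) by rewrite subrKC.
rewrite simplex_homothety//; last by rewrite subr_ge0 ts.
rewrite -/th -/t -xE -exprMn; congr (_ ^+ _).
have -> : x - x / g * (t + (s - t) - t) = (1 - (s - t) / g) * x.
  by field; rewrite lt0r_neq0.
apply/esym/max_idPr; rewrite mulr_ge0// subr_ge0 ler_pdivrMr// mul1r.
exact: ltW.
Qed.

Lemma simplex_is_conic i0 i1 b g : centered K -> i0 != i1 -> 0 <= b -> 0 <= g ->
  exists x k y j, [/\ conic n (msl K (simplex_dir i0 i1 b g)) (simplex_knot i0 i1 b g) x k y j
    & b = 0 -> y = 0 /\ j = 0].
Proof.
move=> cK i01 b0 g0.
have [x [k [x0 k0 _ R1]]] := simplex_right i01 b0 g0.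
have i10 : i1 != i0 by rewrite eq_sym.
have [y [j [y0 j0 by0 L1]]] := simplex_right i10 g0 b0.
exists x, k, y, j; split=> //; split=> // s st.
have -> : msl K (simplex_dir i0 i1 b g) s + s = msl K (simplex_dir i1 i0 g b) (- s).
  by rewrite -(simplex_dirN i0 i1) -flip_msl// /flip !opprK.
rewrite L1 -(simplex_knotN i0 i1); last by rewrite lerN2.
by congr (Num.max 0 _ ^+ _); ring.
Qed.

Lemma simplex_dir_neq0 i0 i1 b g : i0 != i1 -> 0 < b + g -> simplex_dir i0 i1 b g != 0.
Proof.
move=> i01 bg; apply/eqP => d0.
have e1 := simplex_dirE i0 i1 b g (v i1); have e0 := simplex_dirE i0 i1 b g (v i0).
have dv i : dot (v i) (simplex_dir i0 i1 b g) = 0.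
  by rewrite d0 /dot big1// => l _; rewrite mxE mulr0.
have i10 : (i1 == i0) = false by rewrite eq_sym (negbTE i01).
rewrite dv !(bary_vertex av) eqxx (negbTE i01) in e1.
rewrite dv !(bary_vertex av) eqxx i10 in e0.
by move: e0 e1; rewrite /= !mulr0 !mulr1; lra.
Qed.

End simplex_conic.

(** * Matching of moments and comparison with the simplex *)

Lemma ler_cross (R : realFieldType) (a c d e : R) :
  0 < d -> a <= c / d * e -> a * d <= e * c.
Proof. by move=> d0; rewrite mulrAC ler_pdivlMr// (mulrC c). Qed.

Lemma cross_le0 (R : realFieldType) (a b c d : R) :
  a * b <= c * d -> b * a - c * d <= 0.
Proof. by rewrite subr_le0 (mulrC b). Qed.

Lemma cross_ge0 (R : realFieldType) (a b c d : R) :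
  a * b <= c * d -> 0 <= c * d - b * a.
Proof. by rewrite subr_ge0 (mulrC b). Qed.

Lemma cross_eq (R : realFieldType) (a b c d : R) : a != 0 ->
  a * b - c * d = 0 -> d / a * c = b.
Proof.
move=> a0 /eqP; rewrite subr_eq0 => /eqP E.
by apply: (mulfI a0); rewrite E; field.
Qed.

Section mom_compare.
Context (R : realType) (n : nat).
Implicit Types (K : convex_body R n) (th : 'rV[R]_n).

(** E|Y| is positive, and centering splits it into two equal halves, E Y_+ and E Y_-. *)
Lemma msl0_gt0 K th : centered K -> th != 0 -> 0 < msl K th 0.
Proof.
move=> cK th0; have := mean_norm_gt0 K ltr01 th0; rewrite mean_norm_mom//.
have mE u : mom K 1 u = msl K u 0.
  by apply: mean_eq => x _; rewrite powRr1 ?le_max ?lexx// subr0.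
by rewrite !mE -flip_msl// stoploss_flip0; lra.
Qed.

Lemma kint_mom K th p : 1 < p ->
  kint 0 (p - 1)^-1 (msl K th) = (pconst 0 (p - 1)^-1 * mom K p th)%:E.
Proof.
move=> p1; have p10 : 0 < (p - 1)^-1 by rewrite invr_gt0 subr_gt0.
rewrite (kint_msl K th (lexx 0) p10); congr (_ * mean _ _)%:E.
apply/funext => x; congr (_ `^ _).
by rewrite add0r invrK mul1r subrKC.
Qed.

Lemma kint_mom2 K th p q : 1 < p -> p < q ->
  kint ((q - p) / (p - 1)) (p - 1)^-1 (msl K th) =
  (pconst ((q - p) / (p - 1)) (p - 1)^-1 * mom K q th)%:E.
Proof.
move=> p1 pq; have p10 : 0 < (p - 1)^-1 by rewrite invr_gt0 subr_gt0.
have e0 : 0 <= (q - p) / (p - 1) by rewrite divr_ge0//; lra.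
rewrite (kint_msl K th e0 p10); congr (_ * mean _ _)%:E.
apply/funext => x; congr (_ `^ _).
by field; rewrite subr_eq0 gt_eqF.
Qed.

Lemma mom_gt0 K th p : centered K -> th != 0 -> 1 < p -> 0 < mom K p th.
Proof.
move=> cK th0 p1; have p10 : 0 < (p - 1)^-1 by rewrite invr_gt0 subr_gt0.
have c0 : 0 < pconst 0 (p - 1)^-1 by exact: pconst_gt0.
have sU := stoploss_msl th cK; have U0 := msl0_gt0 cK th0.
rewrite -(pmulr_rgt0 _ c0) -lte_fin -(kint_mom K th p1).
set k := (p - 1)^-1 in p10 *.
apply: (@integral_gt0_itv _ _ 0 (msl K th 0 `^ k^-1)).
- by rewrite powR_gt0.
- by apply: measurable_kfun; exact: measurable_stoploss sU.
- by move=> r; apply: kfun_ge0; exact: (sl_ge0 sU).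
move=> r /andP[r0 rU]; rewrite /kfun r0 powRr0 mul1r.
apply: (stoploss_near0 sU); rewrite powR_gt0//=.
have -> : msl K th 0 = (msl K th 0 `^ k^-1) `^ k.
  by rewrite -powRrM mulVf ?powRr1 ?(ltW U0)// lt0r_neq0.
by apply: gt0_ltr_powR; rewrite ?nnegrE ?powR_ge0// ltW.
Qed.

Section compare_with_simplex.
Context (K D : convex_body R n) (v : 'I_n.+1 -> 'rV[R]_n).
Hypotheses (cK : centered K) (cD : centered D).
Hypotheses (av : affinely_independent v) (Dv : convex_body_set D = convex_hull v).
Context (p q : R).
Hypotheses (p1 : 1 < p) (pq : p < q).

Let c0 : 0 < pconst 0 (p - 1)^-1.
Proof. by apply: pconst_gt0 => //; rewrite invr_gt0 subr_gt0. Qed.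

Lemma kint_eq_mom th u : mom D p u = mom K p th ->
  kint 0 (p - 1)^-1 (msl D u) = kint 0 (p - 1)^-1 (msl K th).
Proof. by move=> E; rewrite (kint_mom K th p1) (kint_mom D u p1) E. Qed.

Lemma kint_mom_lty th : (kint 0%R (p - 1)^-1 (msl K th) < +oo)%E.
Proof. by rewrite (kint_mom K th p1) ltry. Qed.

Lemma mom_le_of_kint th u :
  (kint 0%R (p - 1)^-1 (msl K th) <= kint 0%R (p - 1)^-1 (msl D u))%E ->
  mom K p th <= mom D p u.
Proof. by rewrite (kint_mom K th p1) (kint_mom D u p1) lee_fin (ler_pM2l c0). Qed.

Lemma mom_le_of_kint2 th u :
  (kint ((q - p) / (p - 1))%R (p - 1)^-1 (msl K th) <=
   kint ((q - p) / (p - 1))%R (p - 1)^-1 (msl D u))%E ->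
  mom K q th <= mom D q u.
Proof.
have ce : 0 < pconst ((q - p) / (p - 1)) (p - 1)^-1.
  by apply: pconst_gt0; [rewrite divr_ge0// subr_ge0 ltW|rewrite invr_gt0 subr_gt0].
by rewrite (kint_mom2 K th p1 pq) (kint_mom2 D u p1 pq) lee_fin (ler_pM2l ce).
Qed.

(** Scaling the facet normal [u] matches the negative moments, and [kint_extreme] then compares the
    positive ones. The cross-multiplied form is the sign condition used in [mom_match]. *)
Lemma mom_extreme th (i0 i1 : 'I_n.+1) u : th != 0 -> i0 != i1 ->
  u = simplex_dir v i0 i1 0 1 ->
  mom K p th * mom D p (- u) <= mom D p u * mom K p (- th).
Proof.
move=> th0 i01 uE.
have p0 : 0 < p := lt_trans ltr01 p1.
have k0 : 0 < (p - 1)^-1 by rewrite invr_gt0 subr_gt0.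
have u0 : u != 0 by rewrite uE; apply: (simplex_dir_neq0 av) => //; rewrite add0r.
have Nu0 : - u != 0 by rewrite oppr_eq0.
have Nth0 : - th != 0 by rewrite oppr_eq0.
have mu := mom_gt0 cD Nu0 p1.
pose l := (mom K p (- th) / mom D p (- u)) `^ p^-1.
have l0 : 0 <= l by exact: powR_ge0.
have lp : l `^ p = mom K p (- th) / mom D p (- u).
  by rewrite -powRrM mulVf ?lt0r_neq0// powRr1// divr_ge0 ?mom_ge0.
have luE : l *: u = simplex_dir v i0 i1 0 l.
  by rewrite uE /simplex_dir !scale0r !subr0 scale1r.
have [x [k [y [j [con /(_ erefl)[y00 j00]]]]]] :=
  simplex_is_conic av Dv cD i01 (lexx 0) l0.
rewrite y00 j00 -luE in con.
have En : mom D p (- (l *: u)) = mom K p (- th).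
  by rewrite -scalerN (momZ D (- u) (ltW p0) l0) lp divfK// lt0r_neq0.
have h : mom K p th <= mom D p (l *: u).
  apply: mom_le_of_kint; apply: (kint_extreme k0 (stoploss_msl th cK)
    (stoploss_msl (l *: u) cD) con (msl0_gt0 cK th0)).
    by rewrite (flip_msl th cK) (flip_msl (l *: u) cD); exact: kint_eq_mom.
  by rewrite (flip_msl th cK); exact: kint_mom_lty.
rewrite (momZ D u (ltW p0) l0) lp in h.
exact: (ler_cross mu h).
Qed.

Lemma mom_match th (i0 i1 : 'I_n.+1) : th != 0 -> i0 != i1 ->
  exists b g, [/\ 0 <= b, 0 <= g, 0 < b + g,
    mom D p (simplex_dir v i0 i1 b g) = mom K p th &
    mom D p (- simplex_dir v i0 i1 b g) = mom K p (- th)].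
Proof.
move=> th0 i01.
have p0 : 0 < p := lt_trans ltr01 p1.
have Nth0 : - th != 0 by rewrite oppr_eq0.
have i10 : i1 != i0 by rewrite eq_sym.
pose w (k : R) := simplex_dir v i0 i1 (1 - k) k.
have w0 k : w k != 0.
  by apply: (simplex_dir_neq0 av) => //; rewrite subrK.
have mKp := mom_gt0 cK th0 p1; have mKn := mom_gt0 cK Nth0 p1.
(* The equality of the two ratios of moments, cross-multiplied so as to be a zero of a continuous
   function. *)
have Rc : continuous (fun k => mom D p (w k) * mom K p (- th) - mom D p (- w k) * mom K p th).
  have wE k : w k = k *: (bary_dir v i1 + bary_dir v i0) + - bary_dir v i0.
    by rewrite /w /simplex_dir scalerBl scale1r scalerDr opprB addrA.
  have wc : continuous w.
    move=> k; rewrite (_ : w = fun k : R => k *: (bary_dir v i1 + bary_dir v i0) + - bary_dir v i0).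
      by apply: cvgD; [apply: cvgZr_tmp; exact: cvg_id|exact: cvg_cst].
    by apply/funext => z; exact: wE.
  have mc : continuous (mom D p) by apply: mom_continuous; exact: ltW.
  move=> k.
  have c1 : {for k, continuous (mom D p \o w)}.
    by apply: (@continuous_comp _ _ _ w (mom D p)); [exact: wc|exact: mc].
  have c2 : {for k, continuous (mom D p \o (-%R \o w))}.
    apply: (@continuous_comp _ _ _ (-%R \o w) (mom D p)); last exact: mc.
    by apply: (@continuous_comp _ _ _ w -%R); [exact: wc|exact: opp_continuous].
  have cc (c : R) : {for k, continuous (cst c : R -> R)} by exact: cst_continuous.
  exact: (@continuousB R R^o _ ((mom D p \o w) \* cst (mom K p (- th)))
    ((mom D p \o (-%R \o w)) \* cst (mom K p th)) k
    (@continuousM _ _ (mom D p \o w) (cst (mom K p (- th))) k c1 (cc _))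
    (@continuousM _ _ (mom D p \o (-%R \o w)) (cst (mom K p th)) k c2 (cc _))).
(* [w 1] is the normal attached to [i1] and [w 0] the opposite of the one attached to [i0]:
   [mom_extreme] for [th] and for [- th] gives opposite signs. *)
have [k kin Rk] : exists2 k, k \in `[0, 1] &
    mom D p (w k) * mom K p (- th) - mom D p (- w k) * mom K p th = 0.
  apply: IVT => //; first exact: continuous_subspaceT.
  have h1 := mom_extreme th0 i01 erefl; have h0 := mom_extreme Nth0 i10 erefl.
  rewrite ge_min le_max; apply/andP; split; apply/orP; [left|right].
    have E0 : w 0 = - simplex_dir v i1 i0 0 1 by rewrite simplex_dirN /w subr0.
    by rewrite opprK in h0; rewrite E0 opprK; exact: (cross_le0 h0).
  have E1 : w 1 = simplex_dir v i0 i1 0 1 by rewrite /w subrr.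
  by rewrite E1; exact: (cross_ge0 h1).
have mD := mom_gt0 cD (w0 k) p1.
have Nw0 : - w k != 0 by rewrite oppr_eq0.
have mDn := mom_gt0 cD Nw0 p1.
(* This scale fixes the positive moment; the negative one follows, as the ratios agree. *)
pose l := (mom K p th / mom D p (w k)) `^ p^-1.
have lp : l `^ p = mom K p th / mom D p (w k).
  by rewrite -powRrM mulVf ?lt0r_neq0// powRr1// divr_ge0 ?mom_ge0.
have l0 : 0 < l by apply: powR_gt0; exact: divr_gt0 mKp mD.
move: kin; rewrite in_itv/= => /andP[k0 k1].
exists (l * (1 - k)), (l * k).
have lw : simplex_dir v i0 i1 (l * (1 - k)) (l * k) = l *: w k.
  by rewrite /w /simplex_dir scalerBr !scalerA.
rewrite lw -scalerN !(momZ D _ (ltW p0) (ltW l0)) lp; split.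
- by rewrite mulr_ge0 ?(ltW l0)// subr_ge0.
- by rewrite mulr_ge0 ?(ltW l0).
- by rewrite -mulrDr subrK mulr1.
- exact: (divfK (lt0r_neq0 mD)).
- exact: (cross_eq (lt0r_neq0 mD) Rk).
Qed.

Lemma mratio_le_simplex th : (0 < n)%N -> th != 0 ->
  exists2 u, u != 0 & mratio K p q th <= mratio D p q u.
Proof.
move=> n0 th0.
have p0 : 0 < p := lt_trans ltr01 p1.
have q0 : 0 < q := lt_trans p0 pq.
(* Any two distinct vertices serve; [0 < n] provides them. *)
have i01 : ord0 != ord_max :> 'I_n.+1 by rewrite -val_eqE/= eq_sym -lt0n.
have k0 : 0 < (p - 1)^-1 by rewrite invr_gt0 subr_gt0.
have e0 : 0 <= (q - p) / (p - 1) by rewrite divr_ge0// subr_ge0 ltW.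
have Nth0 : - th != 0 by rewrite oppr_eq0.
have [b [g [b0 g0 bg Ep En]]] := mom_match th0 i01.
set u := simplex_dir v _ _ b g in Ep En.
have u0 : u != 0 by exact: (simplex_dir_neq0 av i01 bg).
exists u; first exact: u0.
have [x [k [y [j [con _]]]]] := simplex_is_conic av Dv cD i01 b0 g0.
have h1 : mom K q th <= mom D q u.
  apply: mom_le_of_kint2; apply: (kint_compare k0 e0 (stoploss_msl th cK)
    (stoploss_msl u cD) con (msl0_gt0 cK th0)).
  - exact: kint_eq_mom Ep.
  - exact: kint_mom_lty.
  - by rewrite (flip_msl th cK) (flip_msl u cD); exact: kint_eq_mom En.
  - by rewrite (flip_msl th cK); exact: kint_mom_lty.
(* The negative parts are compared by the same lemma applied to the opposite directions, with the
   flipped cone. *)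
have h2 : mom K q (- th) <= mom D q (- u).
  have := conic_flip con; rewrite (flip_msl u cD) => conf.
  apply: mom_le_of_kint2; apply: (kint_compare k0 e0 (stoploss_msl (- th) cK)
    (stoploss_msl (- u) cD) conf (msl0_gt0 cK Nth0)).
  - exact: kint_eq_mom En.
  - exact: kint_mom_lty.
  - by rewrite (flip_msl (- th) cK) (flip_msl (- u) cD) !opprK; exact: kint_eq_mom Ep.
  - by rewrite (flip_msl (- th) cK) opprK; exact: kint_mom_lty.
rewrite /mratio !(marginal_norm_amom _ _ q0) !(marginal_norm_amom _ _ p0).
have -> : amom D p u = amom K p th by rewrite /amom Ep En.
have A0 (L : convex_body R n) w : 0 <= amom L q w.
  exact: addr_ge0 (mom_ge0 _ _ _) (mom_ge0 _ _ _).
have i0 : 0 <= (amom K p th `^ p^-1)^-1 by rewrite invr_ge0; exact: powR_ge0.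
have qi0 : 0 <= q^-1 by rewrite invr_ge0; exact: ltW.
exact: (ler_wpM2r i0 (ge0_ler_powR qi0 (A0 _ _) (A0 _ _) (lerD h1 h2))).
Qed.

End compare_with_simplex.
End mom_compare.

Theorem theorem1 (R : realType) (n : nat) (p q : R) (K Delta : convex_body R n) :
  (0 < n)%N -> 1 < p -> p < q ->
  centered K -> centered Delta -> is_simplex Delta ->
  alpha p q K <= alpha p q Delta.
Proof.
move=> n0 p1 pq cK cD [v av Dv].
have p1' : 1 <= p by lra.
have q1' : 1 <= q by lra.
have [[th Sth <-] _] := alpha_is_maximum K n0 p1' q1'.
have [u u0 thu] := mratio_le_simplex cK cD av Dv p1 pq n0 (unit_sphere_neq0 Sth).
exact: le_trans thu (mratio_le_alpha Delta n0 p1' q1' u0).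
Qed.
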